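(* Let $a$ be an element in a unital Banach algebra $A$ with $\|1-a\|<1$, and let $p>1$ be an integer. Then Newton's method for the $p$th root, $$X_{k+1}=\tfrac1p\,X_k\,\big((p-1)1+X_k^{-p}\,a\big),$$ with initial point $X_0=1$, converges to $a^{1/p}$; indeed there exist constants $\delta<1$ and $C$ with $\|X_k-a^{1/p}\|\le C\,\delta^{2^k}$ for each $k$ (a bound that converges to $0$ quadratically). In particular, this is the case if $a\in A$ is strictly accretive and $\|1-2a\|\le1$.
   Context: Algebras are complex; a unital Banach algebra has an identity of norm $1$. The numerical range of $x\in A$ is $W(x)=\{\varphi(x):\varphi\in A^*,\ \|\varphi\|=\varphi(1)=1\}$, and $x$ is strictly accretive if $W(x)$ is contained in the open right half plane. For $a$ with spectrum disjoint from $(-\infty,0]$, $a^{1/p}$ denotes the principal $p$th root: the unique $p$th root with spectrum in the interior of the sector $\{z:|\arg z|\le\pi/p\}$. It is part of the claim that the iterates are well defined. *)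

(* Defs.v *)
From HB Require Import structures.
From mathcomp Require Import all_boot all_order all_algebra.
From mathcomp Require Import all_classical all_reals all_analysis.
From mathcomp Require Export complex.

Set Implicit Arguments.
Unset Strict Implicit.
Unset Printing Implicit Defensive.

Import Order.TTheory GRing.Theory Num.Theory.
Import numFieldNormedType.Exports.

Local Open Scope classical_set_scope.
Local Open Scope ring_scope.
Local Open Scope complex_scope.

(* Unital Banach algebras with identity of norm 1.  Hierarchy Builder refuses a
   direct join of [GRing.Algebra] with [CompleteNormedModule] (their only known
   common extensions are numeric domains), so the product and the identity are
   fields here, and the ring and algebra structures are derived from them.
   Over [K = R[i]] the norm takes values in [R[i]]; they are nonnegative reals,
   as [0 <= z] in [R[i]] entails that the imaginary part of [z] is 0. *)
HB.mixin Record isBanachAlgebra (K : numFieldType) A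
    of CompleteNormedModule K A := {
  banach_one : A ;
  banach_mul : A -> A -> A ;
  banach_mulA : associative banach_mul ;
  banach_mul1r : left_id banach_one banach_mul ;
  banach_mulr1 : right_id banach_one banach_mul ;
  banach_mulDl : left_distributive banach_mul +%R ;
  banach_mulDr : right_distributive banach_mul +%R ;
  banach_scaleAl : forall (k : K) (x y : A),
    k *: banach_mul x y = banach_mul (k *: x) y ;
  banach_scaleAr : forall (k : K) (x y : A),
    k *: banach_mul x y = banach_mul x (k *: y) ;
  banach_normM : forall x y : A, `|banach_mul x y| <= `|x| * `|y| ;
  banach_norm1 : `|banach_one| = 1
}.

#[short(type="banachAlgType")]
HB.structure Definition BanachAlgebra (K : numFieldType) :=
  {A of CompleteNormedModule K A & isBanachAlgebra K A}.

Section banach_algebra_instances.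
Variables (K : numFieldType) (A : banachAlgType K).

Let banach_one_neq0 : banach_one != 0 :> A.
Proof. by rewrite -normr_eq0 banach_norm1 oner_eq0. Qed.

#[non_forgetful_inheritance]
HB.instance Definition _ := GRing.Zmodule_isNzRing.Build (BanachAlgebra.sort A)
  (@banach_mulA K A) banach_mul1r banach_mulr1 banach_mulDl banach_mulDr
  banach_one_neq0.

#[non_forgetful_inheritance]
HB.instance Definition _ :=
  GRing.Lmodule_isLalgebra.Build K (BanachAlgebra.sort A) (@banach_scaleAl K A).

#[non_forgetful_inheritance]
HB.instance Definition _ :=
  GRing.Lalgebra_isAlgebra.Build K (BanachAlgebra.sort A) (@banach_scaleAr K A).

Definition banach_unit : pred A :=
  fun x => `[< exists y : A, y * x = 1 /\ x * y = 1 >].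

Definition banach_inv (x : A) : A :=
  xget x [set y : A | y * x = 1 /\ x * y = 1].

Let banach_invP x : banach_unit x ->
  banach_inv x * x = 1 /\ x * banach_inv x = 1.
Proof.
move=> /asboolP xV.
exact: (@xgetPex _ x [set y : A | y * x = 1 /\ x * y = 1] xV).
Qed.

Let banach_mulVr : {in banach_unit, left_inverse 1 banach_inv *%R}.
Proof. by move=> x /banach_invP[]. Qed.

Let banach_divrr : {in banach_unit, right_inverse 1 banach_inv *%R}.
Proof. by move=> x /banach_invP[]. Qed.

Let banach_unitrP (x y : A) : y * x = 1 /\ x * y = 1 -> banach_unit x.
Proof. by move=> xy; apply/asboolP; exists y. Qed.

Let banach_invr_out : {in [predC banach_unit], banach_inv =1 id}.
Proof.
move=> x /negP xN; rewrite /banach_inv; case: xgetP => // y _ xy.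
by exfalso; apply: xN; apply/asboolP; exists y.
Qed.

#[non_forgetful_inheritance]
HB.instance Definition _ := GRing.NzRing_hasMulInverse.Build
  (BanachAlgebra.sort A) banach_mulVr banach_divrr banach_unitrP banach_invr_out.

End banach_algebra_instances.

Section principal_root_newton.
Variables (R : realType) (A : banachAlgType R[i]).
Implicit Types (a x r : A) (p : nat).

Definition spectrum x : set R[i] :=
  [set z | z%:A - x \isn't a GRing.unit].

Definition opnorm (f : A -> R[i]) : R :=
  sup [set complex.Re `|f x| | x in [set x : A | `|x| <= 1]].

(* Continuity is required explicitly: on a set that is not bounded above, [sup]
   returns a dummy value. *)
Definition states : set {linear A -> R[i]^o} :=
  [set f : {linear A -> R[i]^o} | [/\ continuous f, opnorm f = 1 & f 1 = 1]].

Definition numerical_range x : set R[i] :=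
  [set (f : {linear A -> R[i]^o}) x | f in states].

Definition strictly_accretive x : Prop :=
  numerical_range x `<=` [set z | 0 < complex.Re z].

Definition nonpos_reals : set R[i] := [set t%:C | t in [set t : R | t <= 0]].

(* The set of [z] with [`|arg z| <= pi / p], in polar form; it contains 0. *)
Definition sector p : set R[i] :=
  [set z | exists rho theta : R,
     [/\ 0 <= rho, `|theta| <= pi / p%:R
       & z = rho%:C * (cos theta +i* sin theta)]].

Definition root_in_sector p a r : Prop :=
  r ^+ p = a /\ spectrum r `<=` interior (sector p : set R[i]^o).

Definition is_principal_root p a r : Prop :=
  [/\ spectrum a `&` nonpos_reals = set0,
      root_in_sector p a r
    & forall s, root_in_sector p a s -> s = r].

Fixpoint newton p a (k : nat) : A :=
  if k is k'.+1 then
    let X := newton p a k' in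
    p%:R^-1 *: (X * ((p.-1)%:R + X ^- p * a))
  else 1.

(* The first conjunct says that the iterates are well defined, [x^-1] being the
   dummy value [x] when [x] is not invertible. *)
Definition newton_converges p a : Prop :=
  (forall k, newton p a k \is a GRing.unit) /\
  exists r : A,
    [/\ is_principal_root p a r,
        newton p a @ \oo --> r
      & exists delta C : R, [/\ 0 <= delta, delta < 1 &
          forall k, `|newton p a k - r| <= (C * delta ^+ (2 ^ k))%:C]].

End principal_root_newton.

(* Main.v *)
(* Set [e_0 = 1 - a] and [e_(k+1) = f (e_k)] with
   [f z = 1 - (1 - z) (1 - z / p) ^- p].  Newton's iterates are
   [X_(k+1) = X_k (1 - e_k / p)], and [e_k = 1 - X_k ^- p a].  As [f] has
   nonnegative Taylor coefficients with sum 1, starting in degree 2, one gets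
   [|e_k| <= |1 - a| ^ (2 ^ k)], hence quadratic convergence to a pth root [r].

   To locate the spectrum of [r], let [zeta] be the Newton limit for a scalar
   [1 - c] with [|c| < 1]; following arguments along the iteration shows that
   [zeta] is the principal root.  Newton's method applied to a triangular 2x2
   matrix with diagonal [a, 1 - c] produces the divided difference of the root
   function, which is, up to a scalar, an inverse of [sum r^i zeta^(p-1-i)]; so
   no other pth root of [1 - c] belongs to the spectrum of [r].

   If [s] is another root with spectrum in the sector, then [u = s / r] has
   [u ^ p = 1], and on the range of a spectral projection of [u] for an
   eigenvalue other than 1 both [s] and its multiple [r] would have empty
   spectrum, which an elementary form of the spectral radius formula excludes.

   For strictly accretive [a], Hahn-Banach gives [t > 0] with [|1 - t a| < 1], and
   [|1 - a| < 1] follows by convexity from [|1 - 2 a| <= 1]. *)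

Require Import Defs.
From HB Require Import structures.
From mathcomp Require Import all_boot all_order all_algebra.
From mathcomp Require Import all_classical all_reals all_analysis.
From mathcomp Require Import ring lra.

Set Implicit Arguments.
Unset Strict Implicit.
Unset Printing Implicit Defensive.

Import Order.TTheory GRing.Theory Num.Theory.
Import numFieldNormedType.Exports.
Import ComplexField.Normc.

Local Open Scope classical_set_scope.
Local Open Scope ring_scope.
Local Open Scope complex_scope.

(** * Complete ring norms *)

Lemma le_expr_exp2n (R : realDomainType) (q : R) (k : nat) :
  0 <= q <= 1 -> q ^+ (2 ^ k) <= q ^+ k.
Proof.
by move=> q01; apply: ler_wiXn2l; [lra|lra|exact/ltnW/ltn_expl].
Qed.

Lemma le0_geometric (R : realType) (q t C : R) : 0 <= q < 1 ->
  (forall n, t <= C * q ^+ n) -> t <= 0.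
Proof.
move=> /andP[q0 q1] tC.
have h : (C * q ^+ n) @[n --> \oo] --> (0 : R).
  rewrite -[X in _ --> X](mulr0 C); apply: cvgM; first exact: cvg_cst.
  by apply: cvg_expr; rewrite ger0_norm.
by apply: cvgr_to_ge h _; exact: nearW.
Qed.

(** Common setting for the scalars, the algebra [A] and the 2x2 matrices over it, to all of which
    Newton's method is applied. Completeness is stated only for geometric increments and returns a
    limit with the same rate. *)
Record ring_norm (R : realType) (T : nzRingType) (N : T -> R) : Prop := {
  rnorm_ge0 : forall x, 0 <= N x ;
  rnorm0 : N 0 = 0 ;
  rnorm_le0 : forall x, N x <= 0 -> x = 0 ;
  rnormN : forall x, N (- x) = N x ;
  rnormD : forall x y, N (x + y) <= N x + N y ;
  rnorm1 : N 1 <= 1 ;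
  rnormM : forall x y, N (x * y) <= N x * N y ;
  rnorm_complete : forall (u : nat -> T) (C q : R), 0 <= q < 1 ->
    (forall n, N (u n.+1 - u n) <= C * q ^+ n) ->
    exists (l : T) (C' : R), forall n, N (u n - l) <= C' * q ^+ n }.

Section ring_norm_theory.
Variables (R : realType) (T : nzRingType) (N : T -> R).
Hypothesis nN : ring_norm N.
Implicit Types (x y : T).

Lemma rnormB x y : N (x - y) <= N x + N y.
Proof. by rewrite -(rnormN nN y); exact: rnormD. Qed.

Lemma rnorm_distC x y : N (x - y) = N (y - x).
Proof. by rewrite -(rnormN nN) opprB. Qed.

Lemma rnormX x n : N (x ^+ n) <= N x ^+ n.
Proof.
elim: n => [|n IH]; first by rewrite !expr0 rnorm1.
rewrite !exprS (le_trans (rnormM nN _ _))//.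
by apply: ler_wpM2l => //; exact: rnorm_ge0.
Qed.

Lemma rnormMn x n : N (x *+ n) <= N x *+ n.
Proof.
elim: n => [|n IH]; first by rewrite !mulr0n rnorm0.
by rewrite !mulrS (le_trans (rnormD nN _ _))// lerD2l.
Qed.

Lemma rnorm_sum n (F : 'I_n -> T) : N (\sum_(i < n) F i) <= \sum_(i < n) N (F i).
Proof.
elim/big_ind2 : _ => //; first by rewrite rnorm0.
by move=> x1 x2 y1 y2 h1 h2; rewrite (le_trans (rnormD nN _ _))// lerD.
Qed.

(** Convergence with an explicit geometric rate replaces a topology on [T]; sums of errors are
    absorbed by passing to the larger rate. *)
Definition rnorm_cvg (u : nat -> T) (l : T) :=
  exists C q : R, [/\ 0 <= q < 1 & forall n, N (u n - l) <= C * q ^+ n].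

Lemma rnorm_cvg_unique u l l' : rnorm_cvg u l -> rnorm_cvg u l' -> l = l'.
Proof.
move=> [C [q [q01 h]]] [C' [q' [q01' h']]].
apply/eqP; rewrite -subr_eq0; apply/eqP/(rnorm_le0 nN).
apply: (@le0_geometric _ (Num.max q q') _ (`|C| + `|C'|)).
  by rewrite maxElt; case: ifP.
move=> n; have -> : l - l' = - (u n - l) + (u n - l') by rewrite opprB addrA subrK.
rewrite (le_trans (rnormD nN _ _))// rnormN// mulrDl lerD//.
  rewrite (le_trans (h n))//; apply: (@le_trans _ _ (`|C| * q ^+ n)).
    by apply: ler_wpM2r; [rewrite exprn_ge0//; lra|exact: ler_norm].
  apply: ler_wpM2l => //; apply: lerXn2r; rewrite ?nnegrE; first lra.
    by rewrite le_max; apply/orP; left; lra.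
  by rewrite le_max lexx.
rewrite (le_trans (h' n))//; apply: (@le_trans _ _ (`|C'| * q' ^+ n)).
  by apply: ler_wpM2r; [rewrite exprn_ge0//; lra|exact: ler_norm].
apply: ler_wpM2l => //; apply: lerXn2r; rewrite ?nnegrE; first lra.
  by rewrite le_max; apply/orP; left; lra.
by rewrite le_max lexx orbT.
Qed.

Lemma rnorm_cvg_cst l : rnorm_cvg (fun=> l) l.
Proof.
exists 0, 0; split=> [|n]; first by rewrite lexx ltr01.
by rewrite subrr rnorm0// mul0r.
Qed.

Lemma rnorm_cvgM u v l m :
  rnorm_cvg u l -> rnorm_cvg v m -> rnorm_cvg (fun n => u n * v n) (l * m).
Proof.
move=> [C [q [q01 h]]] [D [q' [q01' h']]].
pose s := Num.max q q'.
have s01 : 0 <= s < 1 by rewrite /s maxElt; case: ifP.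
have bnd c (t : R) n : 0 <= t <= s -> c * t ^+ n <= `|c| * s ^+ n.
  move=> ts; apply: (@le_trans _ _ (`|c| * t ^+ n)).
    by apply: ler_wpM2r; [rewrite exprn_ge0//; lra|exact: ler_norm].
  by apply: ler_wpM2l => //; apply: lerXn2r; rewrite ?nnegrE; lra.
have qs : 0 <= q <= s by rewrite /s le_max lexx andbT; lra.
have qs' : 0 <= q' <= s by rewrite /s le_max lexx orbT andbT; lra.
exists ((`|C| + N l) * `|D| + `|C| * N m), s; split=> // n.
have -> : u n * v n - l * m = u n * (v n - m) + (u n - l) * m.
  by rewrite mulrBr mulrBl addrA subrK.
have un : N (u n) <= `|C| + N l.
  rewrite -{1}[u n](subrK l) (le_trans (rnormD nN _ _))// lerD2r.
  rewrite (le_trans (h n))// (le_trans (bnd _ _ _ qs))//.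
  by rewrite ler_piMr// exprn_ile1//; lra.
rewrite (le_trans (rnormD nN _ _))// [leRHS]mulrDl lerD//.
  rewrite (le_trans (rnormM nN _ _))// -mulrA ler_pM ?rnorm_ge0//.
  by rewrite (le_trans (h' n))// bnd.
rewrite (le_trans (rnormM nN _ _))// mulrAC ler_wpM2r ?rnorm_ge0//.
by rewrite (le_trans (h n))// bnd.
Qed.

Lemma rnorm_cvgX u l p : rnorm_cvg u l -> rnorm_cvg (fun n => u n ^+ p) (l ^+ p).
Proof.
move=> ul; elim: p => [|p IH].
  by rewrite expr0; under eq_fun do rewrite expr0; exact: rnorm_cvg_cst.
by rewrite exprS; under eq_fun do rewrite exprS; exact: rnorm_cvgM.
Qed.

(** The inverse is the limit of the geometric sums, and [w = 1 + x * w] gives its bound. *)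
Lemma neumann x : N x < 1 ->
  exists w, [/\ w * (1 - x) = 1, (1 - x) * w = 1 & N w <= (1 - N x)^-1].
Proof.
move=> x1; pose u n := \sum_(i < n) x ^+ i.
have x01 : 0 <= N x < 1 by rewrite rnorm_ge0.
have [|w [C uw]] := @rnorm_complete _ _ _ nN u 1 (N x) x01.
  move=> n; have -> : u n.+1 - u n = x ^+ n by rewrite /u big_ord_recr /= addrAC subrr add0r.
  by rewrite mul1r rnormX.
have cu : rnorm_cvg u w by exists C, (N x).
have u1 n : (1 - x) * u n = 1 - x ^+ n by rewrite -(opprB x) mulNr -subrX1 opprB.
have commu n : u n * (1 - x) = (1 - x) * u n.
  apply/commr_sym/commr_sum => i _; apply: commrX.
  by apply/commr_sym/commrB => //; exact: commr1.
have c1 : rnorm_cvg (fun n => 1 - x ^+ n) 1.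
  exists 1, (N x); split=> // n.
  by rewrite addrAC subrr add0r rnormN// mul1r rnormX.
have w1 : (1 - x) * w = 1.
  apply: rnorm_cvg_unique c1.
  by under eq_fun do rewrite -u1; apply: rnorm_cvgM => //; exact: rnorm_cvg_cst.
have w1' : w * (1 - x) = 1.
  apply: rnorm_cvg_unique c1; under eq_fun do rewrite -u1 -commu.
  by apply: rnorm_cvgM => //; exact: rnorm_cvg_cst.
exists w; split=> //.
have : N w <= 1 + N x * N w.
  have e : w = 1 + x * w by rewrite -{1}w1 mulrBl mul1r subrK.
  rewrite {1}e (le_trans (rnormD nN _ _))// lerD ?rnorm1//; exact: rnormM.
move=> h; rewrite -[leRHS]mul1r ler_pdivlMr ?subr_gt0//.
by rewrite mulrBr mulr1; lra.
Qed.

End ring_norm_theory.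

(** The sum is the formal derivative of [1 + w + ... + w ^+ n]. The identity serves twice: in the
    ring, and at a real number that dominates the norm. *)
Lemma sqr_sub1_derive_geometric (T : nzRingType) (w : T) n :
  1 + w ^+ n.+1 *+ n - w ^+ n *+ n.+1 =
  (w - 1) ^+ 2 * \sum_(j < n) w ^+ j *+ j.+1.
Proof.
elim: n => [|n IH]; first by rewrite big_ord0 mulr0 expr0 mulr0n addr0 subrr.
rewrite big_ord_recr /= mulrDr -IH mulrnAr.
have -> : (w - 1) ^+ 2 * w ^+ n = w ^+ n.+2 - w ^+ n.+1 *+ 2 + w ^+ n.
  rewrite expr2 -mulrA [X in _ * X]mulrBl mul1r -exprS mulrBr !mulrBl !mul1r.
  by rewrite -!exprS opprB mulr2n opprD !addrA addrAC.
rewrite !mulrnDl ?mulNrn -mulrnA.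
set a := w ^+ n.+2; set b := w ^+ n.+1; set c := w ^+ n.
rewrite (_ : (2 * n.+1)%N = (n.+2 + n)%N); last first.
  by rewrite mul2n -addnn addSnnS addnC.
rewrite mulrnDr -[RHS](addrA (1 + b *+ n)) [X in _ = _ + X]addrC addrK.
by rewrite [RHS]addrACA (opprD (b *+ n.+2)) [X in _ = _ + X]addrCA subrr addr0.
Qed.

(** * Newton's method in a complete normed ring *)

Lemma inverse_unique (T : nzRingType) (x w w' : T) :
  w * x = 1 -> x * w' = 1 -> w = w'.
Proof. by move=> wx xw'; rewrite -[w]mulr1 -xw' mulrA wx mul1r. Qed.

Lemma inverse_comm (T : nzRingType) (x w y : T) :
  w * x = 1 -> x * w = 1 -> GRing.comm y x -> GRing.comm y w.
Proof.
move=> wx xw yx.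
by rewrite /GRing.comm -[y * w]mul1r -wx -mulrA (mulrA x) -yx -!mulrA xw mulr1.
Qed.

(** A ring [T] carries no inverse operation, so an inverse is chosen, with value 0 if there is
    none. *)
Definition two_sided_inverse (T : nzRingType) (x : T) : T :=
  xget 0 [set w : T | w * x = 1 /\ x * w = 1].

Lemma two_sided_inverseE (T : nzRingType) (x w : T) :
  w * x = 1 -> x * w = 1 -> two_sided_inverse x = w.
Proof.
move=> wx xw; rewrite /two_sided_inverse; case: xgetP => [w' _ [w'x xw']|].
  exact: inverse_unique w'x xw.
by move=> /(_ w)[].
Qed.

Section newton_residual.
Variables (R : realType) (T : nzRingType) (N : T -> R).
Hypothesis nN : ring_norm N.
Variables (p : nat) (kappa : T).
Hypothesis p1 : (1 < p)%N.
Hypothesis kappaC : forall x, kappa * x = x * kappa.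
Hypothesis kappap : kappa *+ p = 1.
Hypothesis Nkappa : N kappa <= p%:R^-1.

Let p0 : (0 < p%:R :> R). Proof. by rewrite ltr0n ltnW. Qed.
Let pB0 : (0 < p%:R - 1 :> R).
Proof. by rewrite subr_gt0 ltr1n. Qed.

(** The map [f] that sends [e_k] to [e_(k+1)], with the central element [kappa] in the role of
    [1 / p]. *)
Definition residual_step (e : T) : T :=
  1 - two_sided_inverse (1 - kappa * e) ^+ p * (1 - e).

Fixpoint residual (b : T) (k : nat) : T :=
  if k is k'.+1 then residual_step (residual b k') else b.

(** Newton's iteration for [1 - b], driven by the residuals so that no inverse of an iterate
    appears. *)
Fixpoint newton_iter (b : T) (k : nat) : T :=
  if k is k'.+1 then newton_iter b k' * (1 - kappa * residual b k') else 1.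

Lemma kappa_norm e : N (kappa * e) <= N e / p%:R.
Proof.
rewrite (le_trans (rnormM nN _ _))// mulrC ler_wpM2l//.
exact: rnorm_ge0.
Qed.

Lemma kappa_inverse e : N e <= 1 -> exists w,
  [/\ two_sided_inverse (1 - kappa * e) = w, w * (1 - kappa * e) = 1,
      (1 - kappa * e) * w = 1 & N w <= p%:R / (p%:R - 1)].
Proof.
move=> e1.
have ke : N (kappa * e) <= p%:R^-1.
  rewrite (le_trans (kappa_norm e))// -[leRHS]mul1r ler_wpM2r// invr_ge0 ler0n.
have pV1 : p%:R^-1 < 1 :> R by rewrite invf_lt1// ltr1n.
have [|w [wx xw Nw]] := @neumann _ _ _ nN (kappa * e).
  exact: le_lt_trans ke pV1.
exists w; split=> //; first exact: two_sided_inverseE.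
rewrite (le_trans Nw)//.
have -> : p%:R / (p%:R - 1) = (1 - p%:R^-1 : R)^-1.
  field.
  by rewrite !gt_eqF.
by rewrite lef_pV2 ?posrE ?subr_gt0 ?lerD2l ?lerN2// (le_lt_trans ke).
Qed.

(* The power series of [1 - (1 - z) (1 - z / p) ^- p] starts in degree 2 and has
   nonnegative coefficients with sum 1, whence the bound; this is replaced here
   by a closed form in [w = (1 - z / p)^-1]. *)
Lemma residual_step_norm e : N e <= 1 -> N (residual_step e) <= N e ^+ 2.
Proof.
move=> e1; have [w [invE wx xw Nw]] := kappa_inverse e1.
rewrite /residual_step invE; pose n := p.-1.
have pn : p = n.+1 by rewrite prednK// ltnW.
have w1 : w - 1 = kappa * e * w.
  by rewrite -[X in _ - X]xw mulrBl mul1r opprB addrCA subrr addr0.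
have ew : e * w = (w - 1) *+ p.
  by rewrite w1 -mulrA -mulrnAl kappap mul1r.
have commwe : e * w = w * e.
  apply: (inverse_comm wx xw); apply: commrB; first exact: commr1.
  by rewrite /GRing.comm mulrA -kappaC.
(* Since [e * w = p (w - 1)], the left side is the polynomial [1 + n w^(n+1) - (n+1) w^n] in [w]
   alone, with [n = p - 1]. *)
have -> : 1 - w ^+ p * (1 - e) = (w - 1) ^+ 2 * \sum_(j < n) w ^+ j *+ j.+1.
  have wpe : w ^+ p * e = (w ^+ p - w ^+ n) *+ p.
    by rewrite {1}pn exprSr -mulrA -commwe ew mulrnAr mulrBr mulr1 -exprSr -pn.
  rewrite -sqr_sub1_derive_geometric -pn mulrBr mulr1 opprB wpe mulrnBl.
  have -> : w ^+ p *+ p = w ^+ p *+ n + w ^+ p by rewrite {2}pn mulrSr.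
  by rewrite [X in 1 + X]addrAC addrK addrA.
have w0 := rnorm_ge0 nN w; have ee0 := rnorm_ge0 nN e.
set om := p%:R / (p%:R - 1) in Nw.
have om0 : 0 <= om by rewrite divr_ge0 ?ler0n// ltW.
have om1 : om - 1 = om / p%:R.
  by rewrite /om; field; rewrite !gt_eqF.
(* [om] is the value of [w] at [e = 1], so this is the same closed form for [f 1 = 1]. The norm of
   each factor is then compared with its value at [om]. *)
have sum_om : (om / p%:R) ^+ 2 * \sum_(j < n) om ^+ j *+ j.+1 = 1.
  rewrite -om1 -sqr_sub1_derive_geometric exprSr -pn -mulrnAr.
  have -> : om *+ n = p%:R.
    rewrite -mulr_natr (_ : n%:R = p%:R - 1 :> R); last first.
      by rewrite pn -natr1 addrK.
    by rewrite /om divfK// gt_eqF.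
  by rewrite mulr_natr addrK.
rewrite (le_trans (rnormM nN _ _))//.
rewrite -[leRHS]mulr1 -sum_om mulrA ler_pM ?(rnorm_ge0 nN)//.
  rewrite (le_trans (rnormX nN _ _))// -exprMn.
  have w1N : N (w - 1) <= N e * (om / p%:R).
    rewrite w1 (le_trans (rnormM nN _ _))// mulrCA mulrC.
    by rewrite ler_pM ?(rnorm_ge0 nN) ?kappa_norm.
  by rewrite lerXn2r ?nnegrE ?(rnorm_ge0 nN)// (le_trans _ w1N)// (rnorm_ge0 nN).
rewrite (le_trans (rnorm_sum nN _))// ler_sum// => j _.
rewrite (le_trans (rnormMn nN _ _))// lerMn2r (le_trans (rnormX nN _ _))//.
by rewrite lerXn2r ?nnegrE.
Qed.

Variable b : T.
Hypothesis b1 : N b < 1.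
Let b0 : 0 <= N b. Proof. exact: rnorm_ge0. Qed.

Lemma residual_norm k : N (residual b k) <= N b ^+ (2 ^ k).
Proof.
elim: k => [|k IH]; first by rewrite expn0 expr1.
rewrite expnS mulnC exprM (le_trans (residual_step_norm _))//.
  by rewrite (le_trans IH)// exprn_ile1// ltW.
by rewrite lerXn2r ?nnegrE ?exprn_ge0 ?(rnorm_ge0 nN).
Qed.

Lemma residual_le1 k : N (residual b k) <= 1.
Proof. by rewrite (le_trans (residual_norm k))// exprn_ile1// ltW. Qed.

Lemma residual_comm x k : GRing.comm x b -> GRing.comm x (residual b k).
Proof.
move=> xb; elim: k => [//|k IH] /=; apply: commrB; first exact: commr1.
have [w [invE wx xw _]] := kappa_inverse (residual_le1 k).
have xke : GRing.comm x (1 - kappa * residual b k).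
  by apply: commrB; [exact: commr1|apply: commrM => //; rewrite /GRing.comm kappaC].
apply: commrM; last by apply: commrB => //; exact: commr1.
by rewrite invE; apply: commrX; exact: inverse_comm xke.
Qed.

Lemma newton_iter_comm x k : GRing.comm x b -> GRing.comm x (newton_iter b k).
Proof.
move=> xb; elim: k => [|k IH] /=; first exact: commr1.
apply: commrM => //; apply: commrB; first exact: commr1.
by apply: commrM; [rewrite /GRing.comm kappaC|exact: residual_comm].
Qed.

Lemma newton_iter_inverse k :
  exists y, y * newton_iter b k = 1 /\ newton_iter b k * y = 1.
Proof.
elim: k => [|k [y [yX Xy]]] /=; first by exists 1; rewrite mulr1.
have [w [_ wx xw _]] := kappa_inverse (residual_le1 k).
exists (w * y); rewrite -mulrA (mulrA y) yX mul1r wx; split=> //.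
by rewrite -mulrA (mulrA _ w) xw mul1r Xy.
Qed.

(** A step multiplies the iterate by [1 - kappa * e] and [1 - e] by the inverse of the pth power of
    that factor, so the product is invariant. *)
Lemma newton_iter_residual k :
  newton_iter b k ^+ p * (1 - residual b k) = 1 - b.
Proof.
elim: k => [|k IH] /=; first by rewrite expr1n mul1r.
have [w [invE wx xw _]] := kappa_inverse (residual_le1 k).
rewrite /residual_step invE opprB addrCA subrr addr0 exprMn_comm; last first.
  apply/commr_sym/newton_iter_comm/commr_sym/commrB; first exact: commr1.
  apply: commrM; first by rewrite /GRing.comm kappaC.
  exact: residual_comm.
rewrite -[RHS]IH -mulrA; congr (_ * _); rewrite mulrA -exprMn_comm ?xw.
  by rewrite expr1n mul1r.
by rewrite /GRing.comm wx xw.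
Qed.

(** Bounds the product of the factors [1 + N b ^+ i], by [1 + t <= expR t] and the geometric
    series. *)
Definition newton_bound : R := expR (1 - N b)^-1.

Lemma newton_iter_norm k : N (newton_iter b k) <= newton_bound.
Proof.
apply: (@le_trans _ _ (expR (\sum_(i < k) N b ^+ i))).
  elim: k => [|k IH] /=; first by rewrite big_ord0 expR0 rnorm1.
  rewrite big_ord_recr/= expRD (le_trans (rnormM nN _ _))// ler_pM ?(rnorm_ge0 nN)//.
  apply: le_trans (expR_ge1Dx _).
  rewrite (le_trans (rnormB nN _ _))// lerD ?rnorm1//.
  rewrite (le_trans (kappa_norm _))// ler_pdivrMr//.
  apply: (@le_trans _ _ (N b ^+ k)); last first.
    by rewrite ler_peMr ?exprn_ge0// ler1n ltnW.
  by rewrite (le_trans (residual_norm _))// le_expr_exp2n// b0 ltW.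
rewrite ler_expR -[leRHS]mul1r ler_pdivlMr ?subr_gt0// mulrC.
rewrite -[1 - N b]opprB mulNr -subrX1 opprB gerBl exprn_ge0//.
Qed.

Lemma newton_iter_step k :
  N (newton_iter b k.+1 - newton_iter b k) <= newton_bound * N b ^+ (2 ^ k).
Proof.
rewrite /= mulrBr mulr1 addrAC subrr add0r rnormN//.
rewrite (le_trans (rnormM nN _ _))// ler_pM ?(rnorm_ge0 nN) ?newton_iter_norm//.
rewrite (le_trans (kappa_norm _))// ler_pdivrMr//.
rewrite (le_trans (residual_norm _))// ler_peMr ?exprn_ge0// ler1n ltnW//.
Qed.

Lemma newton_iter_gap k m :
  N (newton_iter b (m + k) - newton_iter b k) <=
  newton_bound / (1 - N b) * N b ^+ (2 ^ k).
Proof.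
have M0 : 0 <= newton_bound by exact: expR_ge0.
apply: (@le_trans _ _ (newton_bound * (\sum_(i < m) N b ^+ i) * N b ^+ (2 ^ k))).
  elim: m => [|m IH]; first by rewrite add0n subrr big_ord0 mulr0 mul0r rnorm0.
  rewrite addSn -(subrK (newton_iter b (m + k)) (newton_iter b (m + k).+1)) -addrA.
  rewrite (le_trans (rnormD nN _ _))// big_ord_recr mulrDr mulrDl [leRHS]addrC lerD//.
  rewrite (le_trans (newton_iter_step (m + k)))// -[leRHS]mulrA ler_wpM2l//.
  rewrite /= -exprD.
  apply: ler_wiXn2l => //; first exact: ltW.
  (* It remains that [m + 2 ^ k <= 2 ^ (m + k)]; this makes the tail a geometric series with the
     common factor [N b ^+ (2 ^ k)]. *)
  rewrite expnD addnC; apply: (@leq_trans (m.+1 * 2 ^ k)%N).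
    by rewrite mulSn leq_add2l leq_pmulr// expn_gt0.
  by rewrite leq_mul2r ltn_expl ?orbT.
rewrite ler_wpM2r ?exprn_ge0// ler_wpM2l//.
rewrite -[leRHS]mul1r ler_pdivlMr ?subr_gt0// mulrC.
by rewrite -[1 - N b]opprB mulNr -subrX1 opprB gerBl exprn_ge0.
Qed.

Lemma newton_limit : exists l, [/\ rnorm_cvg N (newton_iter b) l, l ^+ p = 1 - b
  & exists C, forall k, N (newton_iter b k - l) <= C * N b ^+ (2 ^ k)].
Proof.
have b01 : 0 <= N b < 1 by rewrite b0.
have pow2 k : N b ^+ (2 ^ k) <= N b ^+ k by rewrite le_expr_exp2n// b0 ltW.
have M0 : 0 <= newton_bound by exact: expR_ge0.
have [|l [C' Xl]] := @rnorm_complete _ _ _ nN (newton_iter b) newton_bound _ b01.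
  by move=> n; rewrite (le_trans (newton_iter_step n))// ler_wpM2l.
have cX : rnorm_cvg N (newton_iter b) l by exists C', (N b).
exists l; split=> //.
  have c1 : rnorm_cvg N (fun n => 1 - residual b n) 1.
    exists 1, (N b); split=> // n; rewrite addrAC subrr add0r rnormN// mul1r.
    by rewrite (le_trans (residual_norm n)).
  have := rnorm_cvgM nN (rnorm_cvgX nN p cX) c1; rewrite mulr1.
  under [X in rnorm_cvg _ X]eq_fun do rewrite newton_iter_residual.
  by move/(rnorm_cvg_unique nN); apply; exact: rnorm_cvg_cst.
exists (newton_bound / (1 - N b)) => k; rewrite -subr_le0.
(* The iterate of index [m + k] is inserted; its distance to [l] vanishes as [m] grows, and the gap
   bound does not depend on [m]. *)
apply: (@le0_geometric _ (N b) _ (C' * N b ^+ k)) => // m.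
rewrite lerBlDr -mulrA -exprD addnC [leRHS]addrC.
rewrite -(subrK (newton_iter b (m + k)) (newton_iter b k)) -addrA.
rewrite (le_trans (rnormD nN _ _))// lerD//.
by rewrite (rnorm_distC nN) newton_iter_gap.
Qed.

End newton_residual.

(** * Norms on complex Banach algebras and matrices *)

Section geometric_completeness.
Variables (R : realType) (K : numFieldType) (V : completeNormedModType K).
Variables (N : V -> R) (toK : R -> K).
Hypothesis normE : forall x : V, `|x| = toK (N x).
Hypothesis toK_lt : {mono toK : x y / x < y}.
Hypothesis toK_gt0 : forall e : K, 0 < e -> exists2 r, 0 < r & e = toK r.
Hypothesis ND : forall x y, N (x + y) <= N x + N y.
Hypothesis N0 : N 0 = 0.
Hypothesis NN : forall x, N (- x) = N x.

(** The embedding [toK] lets one argument serve both [R] over itself and [A] over [R[i]], whose norm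
    takes values in [R[i]]. *)
Lemma geometric_complete (u : nat -> V) (C q : R) : 0 <= q < 1 ->
  (forall n, N (u n.+1 - u n) <= C * q ^+ n) ->
  exists l C', (u @ \oo --> l) /\ forall n, N (u n - l) <= C' * q ^+ n.
Proof.
move=> q01 uC.
have N_ge0 x : 0 <= N x.
  have := ND x (- x); rewrite subrr N0 NN; lra.
have C0 : 0 <= C by have := uC 0%N; rewrite expr0 mulr1; apply: le_trans.
have q'0 : 0 < 1 - q by lra.
have gap n m : N (u (m + n)%N - u n) <= C / (1 - q) * q ^+ n.
  apply: (@le_trans _ _ (C * (\sum_(i < m) q ^+ i) * q ^+ n)).
    elim: m => [|m IH]; first by rewrite add0n subrr big_ord0 mulr0 mul0r N0.
    rewrite addSn -(subrK (u (m + n)%N) (u (m + n).+1)) -addrA.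
    rewrite (le_trans (ND _ _))// big_ord_recr mulrDr mulrDl [leRHS]addrC lerD//.
    by rewrite (le_trans (uC _))//= -[leRHS]mulrA -exprD.
  rewrite ler_wpM2r ?exprn_ge0//; first lra.
  rewrite ler_wpM2l// -[leRHS]mul1r ler_pdivlMr// mulrC.
  by rewrite -[1 - q]opprB mulNr -subrX1 opprB gerBl exprn_ge0//; lra.
have small (e : R) : 0 < e -> exists n, C / (1 - q) * q ^+ n < e.
  move=> e0; apply/not_existsP => h.
  have := @le0_geometric R q e (C / (1 - q)) q01; rewrite leNgt e0 => /(_ _)/negP.
  by apply=> // n; have /negP := h n; rewrite -leNgt.
have cu : cvg (u @ \oo).
  apply: cauchy_cvg; apply: cauchy_exP => e /toK_gt0[r r0 ->].
  have [n nr] := small _ r0; exists (u n); exists n => // m /= nm.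
  rewrite /ball_ -ball_normE /= normE toK_lt -NN opprB -(subnK nm).
  exact: le_lt_trans (gap _ _) nr.
exists (lim (u @ \oo)), (C / (1 - q)); split=> // n.
apply/ler_addgt0Pr => e e0.
have tKe : 0 < toK e.
  by rewrite -[ltLHS](normr0 V) normE N0 toK_lt.
have /cvgrPdist_lt/(_ _ tKe)[m _ /(_ (m + n)%N) /=] := cu.
rewrite leq_addr normE toK_lt => /(_ isT) lum.
rewrite -(subrK (u (m + n)%N) (u n)) -addrA (le_trans (ND _ _))// lerD//.
  by rewrite -NN opprB.
by rewrite -NN opprB ltW.
Qed.

End geometric_completeness.

Section complex_norm.
Variable R : realType.

Definition cnorm (V : normedModType R[i]) (x : V) : R := complex.Re `|x|.

Section normed_module.
Variable V : normedModType R[i].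
Implicit Types x y : V.

Lemma cnormE x : `|x| = (cnorm x)%:C.
Proof. by rewrite /cnorm RRe_real// normr_real. Qed.

Lemma cnorm_le x y : (cnorm x <= cnorm y) = (`|x| <= `|y|).
Proof. by rewrite !cnormE lecR. Qed.

Lemma cnorm_leC x (c : R) : (cnorm x <= c) = (`|x| <= c%:C).
Proof. by rewrite cnormE lecR. Qed.

Lemma cnorm_ltC x (c : R) : (cnorm x < c) = (`|x| < c%:C).
Proof. by rewrite cnormE ltcR. Qed.

Lemma cnorm_ge0 x : 0 <= cnorm x.
Proof. by rewrite -ler0c -cnormE. Qed.

Lemma cnorm0 : cnorm (0 : V) = 0.
Proof. by rewrite /cnorm normr0. Qed.

Lemma cnorm_le0 x : cnorm x <= 0 -> x = 0.
Proof. by rewrite cnorm_leC normr_le0 => /eqP. Qed.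

Lemma cnormN x : cnorm (- x) = cnorm x.
Proof. by rewrite /cnorm normrN. Qed.

Lemma cnormD x y : cnorm (x + y) <= cnorm x + cnorm y.
Proof. by rewrite cnorm_leC rmorphD /= -!cnormE ler_normD. Qed.

Lemma cnormZ (c : R[i]) x : cnorm (c *: x) = cnorm (c : R[i]^o) * cnorm x.
Proof.
apply: (@complexI R); rewrite rmorphM /= -!cnormE.
exact: normrZ.
Qed.

End normed_module.

Lemma cnormRe (c : R[i]) : `|complex.Re c| <= cnorm (c : R[i]^o).
Proof. by rewrite -lecR -cnormE normc_ge_Re. Qed.

Lemma cnormIm (c : R[i]) : `|complex.Im c| <= cnorm (c : R[i]^o).
Proof.
rewrite -[complex.Im c]opprK normrN -ReiNIm (le_trans (cnormRe _))//.
rewrite cnorm_le normrM (_ : `|'i%C| = 1) ?mulr1//.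
by rewrite normc_def /= expr0n /= add0r expr1n sqrtr1.
Qed.

Lemma cnorm_real (t : R) : cnorm (t%:C : R[i]^o) = `|t|.
Proof. by rewrite /cnorm normc_def /= expr0n /= addr0 sqrtr_sqr. Qed.

Lemma complex_ring_norm : @ring_norm R R[i] (fun c => cnorm (c : R[i]^o)).
Proof.
split.
- by move=> x; exact: cnorm_ge0.
- exact: cnorm0.
- by move=> x; exact: (@cnorm_le0 R[i]^o).
- by move=> x; exact: cnormN.
- by move=> x y; exact: cnormD.
- by rewrite /cnorm normr1.
- by move=> x y; rewrite -(cnormZ x (y : R[i]^o)).
- move=> u C q q01 uC.
  (* Completeness is proved coordinatewise: [f] will be the real and the imaginary part. *)
  have comp (f : R[i] -> R) : (forall c, `|f c| <= cnorm (c : R[i]^o)) ->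
      (forall x y, f (x - y) = f x - f y) ->
      exists l C', forall n, `|f (u n) - l| <= C' * q ^+ n.
    move=> fN fB.
    have [|l [C' [_ h]]] := @geometric_complete R R R (fun x => `|x|) id
      (fun=> erefl) (fun _ _ => erefl) (fun e e0 => ex_intro2 _ _ e e0 erefl)
      (@ler_normD _ _) (normr0 _) (@normrN _ _) (f \o u) C q q01.
      by move=> n /=; rewrite -fB (le_trans (fN _)).
    by exists l, C'.
  have [a [A ha]] := comp _ cnormRe (raddfB (@complex.Re R : Rcomplex R -> R)).
  have [b [B hb]] := comp _ cnormIm (raddfB (@complex.Im R : Rcomplex R -> R)).
  exists (a +i* b), (A + B) => n.
  have -> : u n - (a +i* b) =
      (complex.Re (u n) - a)%:C + 'i * (complex.Im (u n) - b)%:C.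
    rewrite [u n]complexE; apply/eqP; rewrite eq_complex /=.
    by apply/andP; split; apply/eqP; ring.
  rewrite (le_trans (cnormD _ _))// mulrDl lerD//; first by rewrite cnorm_real.
  have := cnormZ 'i%C ((complex.Im (u n) - b)%:C : R[i]^o).
  rewrite cnorm_real (_ : cnorm ('i%C : R[i]^o) = 1) ?mul1r => [->//|].
  by rewrite /cnorm normc_def /= expr0n /= add0r expr1n sqrtr1.
Qed.

End complex_norm.

Section banach_norm.
Variables (R : realType) (A : banachAlgType R[i]).

Lemma banach_geometric_complete (u : nat -> A) (C q : R) : 0 <= q < 1 ->
  (forall n, cnorm (u n.+1 - u n) <= C * q ^+ n) ->
  exists l C', (u @ \oo --> l) /\ forall n, cnorm (u n - l) <= C' * q ^+ n.
Proof.
apply: (@geometric_complete R R[i] A (@cnorm R A) (real_complex R)).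
- exact: cnormE.
- exact: ltcR.
- move=> e e0; exists (complex.Re e); first by move: e0; rewrite ltcE => /andP[].
  by rewrite RRe_real// gtr0_real.
- exact: cnormD.
- exact: cnorm0.
- exact: cnormN.
Qed.

Lemma banach_ring_norm : @ring_norm R A (@cnorm R A).
Proof.
split.
- exact: cnorm_ge0.
- exact: cnorm0.
- exact: cnorm_le0.
- exact: cnormN.
- exact: cnormD.
- by rewrite /cnorm banach_norm1.
- by move=> x y; rewrite cnorm_leC rmorphM /= -!cnormE banach_normM.
- move=> u C q q01 /(banach_geometric_complete q01)[l [C' [_ h]]].
  by exists l, C'.
Qed.

Lemma cnorm_alg (c : R[i]) : cnorm (c%:A : A) = cnorm (c : R[i]^o).
Proof. by rewrite cnormZ [X in _ * X]/cnorm banach_norm1 mulr1. Qed.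

End banach_norm.

Section matrix_norm.
Variables (R : realType) (T : nzRingType) (N : T -> R).
Hypothesis nN : ring_norm N.
Variable n : nat.

(** The maximal row sum: under it a triangular matrix with diagonal of norm below 1 and a small
    off-diagonal entry still has norm below 1. *)
Definition mxrnorm (M : 'M[T]_n.+1) : R :=
  \big[Num.max/0]_(i < n.+1) \sum_(j < n.+1) N (M i j).

Lemma mxrnorm_leP (M : 'M[T]_n.+1) (c : R) : 0 <= c ->
  reflect (forall i, \sum_(j < n.+1) N (M i j) <= c) (mxrnorm M <= c).
Proof.
move=> c0; apply: (iffP (bigmax_leP _ _ _ _)) => [[_ h] i|h]; first exact: h.
by split=> // i _; exact: h.
Qed.

Lemma mxrnorm_row (M : 'M[T]_n.+1) i : \sum_(j < n.+1) N (M i j) <= mxrnorm M.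
Proof. exact: le_bigmax. Qed.

Lemma mxrnorm_entry (M : 'M[T]_n.+1) i j : N (M i j) <= mxrnorm M.
Proof.
rewrite (le_trans _ (mxrnorm_row M i))// (bigD1 j)//= lerDl sumr_ge0// => k _.
exact: rnorm_ge0.
Qed.

Lemma mxrnorm_ge0 (M : 'M[T]_n.+1) : 0 <= mxrnorm M.
Proof. exact: bigmax_ge_id. Qed.

Lemma matrix_ring_norm : ring_norm mxrnorm.
Proof.
split.
- exact: mxrnorm_ge0.
- apply/eqP; rewrite eq_le mxrnorm_ge0 andbT; apply/mxrnorm_leP => // i.
  by rewrite big1// => j _; rewrite mxE rnorm0.
- move=> M M0; apply/matrixP => i j; rewrite mxE; apply: (rnorm_le0 nN).
  exact: le_trans (mxrnorm_entry _ _ _) M0.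
- move=> M; rewrite /mxrnorm; apply: eq_bigr => i _; apply: eq_bigr => j _.
  by rewrite mxE rnormN.
- move=> M M'; apply/mxrnorm_leP; first by rewrite addr_ge0 ?mxrnorm_ge0.
  move=> i; apply: le_trans (lerD (mxrnorm_row M i) (mxrnorm_row M' i)).
  by rewrite -big_split/=; apply: ler_sum => j _; rewrite mxE rnormD.
- apply/mxrnorm_leP => // i; rewrite (bigD1 i)//= big1 ?addr0.
    by rewrite mxE eqxx (rnorm1 nN).
  by move=> j ji; rewrite mxE eq_sym (negbTE ji) (rnorm0 nN).
- move=> M M'; apply/mxrnorm_leP; first by rewrite mulr_ge0 ?mxrnorm_ge0.
  move=> i; apply: (@le_trans _ _ (\sum_j \sum_k N (M i k) * N (M' k j))).
    apply: ler_sum => j _; rewrite mxE (le_trans (rnorm_sum nN _))//.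
    by apply: ler_sum => k _; exact: rnormM.
  rewrite exchange_big/=.
  apply: (@le_trans _ _ (\sum_k N (M i k) * mxrnorm M')).
    apply: ler_sum => k _; rewrite -mulr_sumr ler_wpM2l ?(rnorm_ge0 nN)//.
    exact: mxrnorm_row.
  by rewrite -mulr_suml ler_wpM2r ?mxrnorm_ge0// mxrnorm_row.
- move=> u C q q01 uC.
  have /choice[l ul] : forall ij : 'I_n.+1 * 'I_n.+1, exists lC : T * R,
      forall k, N (u k ij.1 ij.2 - lC.1) <= lC.2 * q ^+ k.
    move=> [i j] /=.
    have [|l [C' h]] := rnorm_complete nN (u := fun k => u k i j) (C := C) q01.
      move=> k; have := le_trans (mxrnorm_entry (u k.+1 - u k) i j) (uC k).
      by rewrite !mxE.
    by exists (l, C').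
  exists (\matrix_(i, j) (l (i, j)).1), (\sum_i \sum_j `|(l (i, j)).2|) => k.
  have [q0 _] := andP q01.
  apply/mxrnorm_leP.
    by rewrite mulr_ge0 ?exprn_ge0// sumr_ge0// => i _; exact: sumr_ge0.
  move=> i; apply: (@le_trans _ _ (\sum_j `|(l (i, j)).2| * q ^+ k)).
    apply: ler_sum => j _; rewrite !mxE (le_trans (ul (i, j) k))//.
    by rewrite ler_wpM2r ?exprn_ge0// ler_norm.
  rewrite -mulr_suml ler_wpM2r ?exprn_ge0//.
  by rewrite [leRHS](bigD1 i)//= lerDl sumr_ge0// => m _; exact: sumr_ge0.
Qed.

End matrix_norm.

(** * Divided differences from triangular matrices *)

Section triangular.
Variable T : nzRingType.
Implicit Types x y z : T.

Definition upper2 x y z : 'M[T]_2 :=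
  \matrix_(i, j) if i == 0 then (if j == 0 then x else y)
                 else (if j == 0 then 0 else z).

Lemma upper2_00 x y z : upper2 x y z 0 0 = x. Proof. by rewrite mxE. Qed.
Lemma upper2_01 x y z : upper2 x y z 0 1 = y. Proof. by rewrite mxE. Qed.
Lemma upper2_10 x y z : upper2 x y z 1 0 = 0. Proof. by rewrite mxE. Qed.
Lemma upper2_11 x y z : upper2 x y z 1 1 = z. Proof. by rewrite mxE. Qed.

Lemma matrix2P (M M' : 'M[T]_2) : M 0 0 = M' 0 0 -> M 0 1 = M' 0 1 ->
  M 1 0 = M' 1 0 -> M 1 1 = M' 1 1 -> M = M'.
Proof.
have ordP (i : 'I_2) : i = 0 \/ i = 1.
  by case: i => [[|[|//]] ?]; [left|right]; exact: val_inj.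
by move=> *; apply/matrixP => i j; case: (ordP i) => ->; case: (ordP j) => ->.
Qed.

Definition upper2E := (upper2_00, upper2_01, upper2_10, upper2_11).

Lemma mulmx2E (M M' : 'M[T]_2) i j : (M * M') i j = M i 0 * M' 0 j + M i 1 * M' 1 j.
Proof.
rewrite mxE big_ord_recl big_ord1.
by congr (_ + M i _ * M' _ j); exact: val_inj.
Qed.

Lemma upper2M x y z x' y' z' :
  upper2 x y z * upper2 x' y' z' = upper2 (x * x') (x * y' + y * z') (z * z').
Proof.
by apply: matrix2P; rewrite mulmx2E !upper2E ?mulr0 ?mul0r ?addr0 ?add0r.
Qed.

Lemma upper2B x y z x' y' z' :
  upper2 x y z - upper2 x' y' z' = upper2 (x - x') (y - y') (z - z').
Proof. by apply: matrix2P; rewrite !mxE/= ?subr0. Qed.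

Lemma upper2_1 : 1 = upper2 1 0 1.
Proof. by apply: matrix2P; rewrite !mxE. Qed.

(** The off-diagonal entry is the noncommutative divided difference of the power function at [x] and
    [z]. *)
Lemma upper2X x y z n : upper2 x y z ^+ n =
  upper2 (x ^+ n) (\sum_(i < n) x ^+ i * y * z ^+ (n.-1 - i)) (z ^+ n).
Proof.
elim: n => [|n IH]; first by rewrite big_ord0 !expr0 upper2_1.
rewrite exprSr IH upper2M -!exprSr; congr upper2.
rewrite big_ord_recr /= subnn expr0 mulr1 addrC; congr (_ + _).
rewrite mulr_suml; apply: eq_bigr => i _; rewrite -mulrA -exprSr.
by case: n i {IH} => [[]//|n] i /=; rewrite subSn// -ltnS.
Qed.

Lemma upper2_inverse x y z x' z' : x' * x = 1 -> x * x' = 1 ->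
  z' * z = 1 -> z * z' = 1 ->
  two_sided_inverse (upper2 x y z) = upper2 x' (- (x' * y * z')) z'.
Proof.
move=> x'x xx' z'z zz'; apply: two_sided_inverseE.
  by rewrite upper2M x'x z'z mulNr -(mulrA _ z') z'z mulr1 subrr -upper2_1.
by rewrite upper2M xx' zz' mulrN !mulrA xx' mul1r addNr -upper2_1.
Qed.

End triangular.

Section newton_triangular.
Variables (R : realType) (T : nzRingType) (N : T -> R).
Hypothesis nN : ring_norm N.
Variables (p : nat) (kappa : T).
Hypothesis p1 : (1 < p)%N.
Hypothesis kappaC : forall x, kappa * x = x * kappa.
Hypothesis kappap : kappa *+ p = 1.
Hypothesis Nkappa : N kappa <= p%:R^-1.
Variables b c eta : T.
Hypothesis b1 : N b < 1.
Hypothesis c1 : N c < 1.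
Hypothesis beta1 : N b + N eta < 1.

Let kappaM : 'M[T]_2 := upper2 kappa 0 kappa.

(** The diagonal entries evolve independently. The off-diagonal entry is left unspecified, as only
    the existence of its limit matters. *)
Lemma residual_upper2 k : exists y,
  residual p kappaM (upper2 b eta c) k =
  upper2 (residual p kappa b k) y (residual p kappa c k).
Proof.
elim: k => [|k [y IH]] /=; first by exists eta.
have [w [wE wx xw _]] := kappa_inverse nN p1 Nkappa
  (residual_le1 nN p1 kappaC kappap Nkappa b1 k).
have [v [vE vx xv _]] := kappa_inverse nN p1 Nkappa
  (residual_le1 nN p1 kappaC kappap Nkappa c1 k).
rewrite IH /residual_step upper2M mul0r addr0 upper2_1 !upper2B.
rewrite (upper2_inverse _ wx xw vx xv) wE vE upper2X upper2M upper2B.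
by eexists; congr upper2.
Qed.

Lemma newton_iter_upper2 k : exists y,
  newton_iter p kappaM (upper2 b eta c) k =
  upper2 (newton_iter p kappa b k) y (newton_iter p kappa c k).
Proof.
elim: k => [|k [y IH]] /=; first by exists 0; rewrite upper2_1.
have [z ->] := residual_upper2 k.
rewrite IH upper2M mul0r addr0 upper2_1 upper2B upper2M.
by eexists; congr upper2.
Qed.

(* The off-diagonal entry of the root of [upper2 (1 - b) (- eta) (1 - c)] is the
   divided difference of the root function at [1 - b] and [1 - c]. *)
Lemma newton_limit_divided_difference l m :
  rnorm_cvg N (newton_iter p kappa b) l -> rnorm_cvg N (newton_iter p kappa c) m ->
  exists h, \sum_(i < p) l ^+ i * h * m ^+ (p.-1 - i) = - eta.
Proof.
move=> bl cm; have nM := matrix_ring_norm nN 1.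
have [|||| L [Lcvg LX _]] := @newton_limit _ _ _ nM p kappaM p1 _ _ _ (upper2 b eta c).
- move=> M; apply: matrix2P;
    by rewrite !mulmx2E !upper2E ?mulr0 ?mul0r ?addr0 ?add0r kappaC.
- by apply: matrix2P; rewrite mulmxnE upper2E ?mul0rn -?upper2_1 ?mxE/= ?kappap.
- apply/mxrnorm_leP; rewrite ?invr_ge0// => i.
  rewrite big_ord_recl big_ord1 !mxE/=; case: ifP => _.
    by rewrite (rnorm0 nN) addr0.
  by rewrite (rnorm0 nN) add0r.
- rewrite (@le_lt_trans _ _ (Num.max (N b + N eta) (N c)))//.
    apply/mxrnorm_leP; first by rewrite le_max addr_ge0 ?(rnorm_ge0 nN).
    move=> i; rewrite big_ord_recl big_ord1 !mxE/= le_max; case: ifP => _.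
      by rewrite lexx.
    by rewrite (rnorm0 nN) add0r lexx orbT.
  by rewrite gt_max beta1.
have entry i j : rnorm_cvg N (fun k => newton_iter p kappaM (upper2 b eta c) k i j) (L i j).
  move: Lcvg => [C [q [q01 h]]]; exists C, q; split=> // k.
  by have := le_trans (mxrnorm_entry nN _ i j) (h k); rewrite !mxE.
(* Entrywise convergence keeps the triangular shape and identifies the diagonal; the (0, 1) entry of
   the pth power then gives the claim. *)
have LE : L = upper2 l (L 0 1) m.
  apply: matrix2P; rewrite upper2E//.
  - apply: (rnorm_cvg_unique nN (entry 0 0)); under eq_fun => k.
      have [y ->] := newton_iter_upper2 k; rewrite upper2E; over.
    by [].
  - apply: (rnorm_cvg_unique nN (entry 1 0)); under eq_fun => k.
      have [y ->] := newton_iter_upper2 k; rewrite upper2E; over.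
    exact: rnorm_cvg_cst.
  - apply: (rnorm_cvg_unique nN (entry 1 1)); under eq_fun => k.
      have [y ->] := newton_iter_upper2 k; rewrite upper2E; over.
    by [].
exists (L 0 1); move: LX; rewrite LE upper2X upper2_1 upper2B.
by move/(congr1 (fun M : 'M[T]_2 => M 0 1)); rewrite !upper2E sub0r.
Qed.

End newton_triangular.

(** * Polar coordinates and sectors *)

Section polar.
Variable R : realType.
Implicit Types (x y t : R) (z w v : R[i]).

Lemma norm_atan_le x : `|atan x| <= `|x|.
Proof.
wlog x0 : x / 0 <= x => [h|].
  have [|/ltW x0] := leP 0 x; first exact: h.
  by rewrite -(normrN x) -(normrN (atan x)) -atanN; apply: h; rewrite oppr_ge0.
have [->|xN0] := eqVneq x 0; first by rewrite atan0.
have xp : 0 < x by rewrite lt_neqAle eq_sym xN0.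
have catan : {within `[0, x], continuous (@atan R)}.
  by apply: continuous_subspaceT => t; exact: continuous_atan.
have [c _] := MVT xp (fun t _ => is_derive1_atan t) catan.
rewrite atan0 !subr0 => ->; rewrite normrM ger0_norm ?invr_ge0 ?addr_ge0 ?sqr_ge0//.
by rewrite ler_piMl// invf_le1 ?lerDl ?sqr_ge0// ltr_wpDr ?sqr_ge0.
Qed.

Definition expi t : R[i] := cos t +i* sin t.

Lemma expi0 : expi 0 = 1.
Proof. by rewrite /expi cos0 sin0. Qed.

Lemma expiD x y : expi (x + y) = expi x * expi y.
Proof.
rewrite /expi cosD sinD; apply/eqP; rewrite eq_complex /=.
by rewrite eqxx addrC eqxx.
Qed.

Lemma expiX x n : expi x ^+ n = expi (x *+ n).
Proof.
elim: n => [|n IH]; first by rewrite expr0 mulr0n expi0.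
by rewrite exprS IH mulrS expiD.
Qed.

Lemma normc_expi x : normc (expi x) = 1.
Proof. by rewrite /= cos2Dsin2 sqrtr1. Qed.

(** Here [cos (x - y) = 1], so the sine of half of [|x - y|] vanishes, while that half lies in
    [[0, pi)]. *)
Lemma expi_inj x y : `|x - y| < pi *+ 2 -> expi x = expi y -> x = y.
Proof.
move=> xy [cE sE].
have c1 : cos (x - y) = 1 by rewrite cosB cE sE -!expr2 cos2Dsin2.
apply/eqP; rewrite -subr_eq0; apply/eqP/normr0_eq0.
set t := `|x - y| in xy *.
have : cos t = 1 by rewrite cos_norm.
have -> : t = (t / 2) *+ 2 by rewrite mulr2n; lra.
rewrite cos_mulr2n cos2sin2 => s0.
have {}s0 : sin (t / 2) = 0.
  by apply/eqP; rewrite -sqrf_eq0; apply/eqP; move: s0; rewrite mulr2n; lra.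
have t0 : 0 <= t by exact: normr_ge0.
have [->|tN0] := eqVneq t 0; first by rewrite mul0r mul0rn.
have := @sin_gt0_pi R (t / 2); rewrite s0 ltxx => h.
have : false by apply: h; apply/andP; split; move: xy; rewrite mulr2n; lra.
by [].
Qed.

Lemma polar_inj (r s x y : R) : 0 < r -> 0 < s ->
  r%:C * expi x = s%:C * expi y -> r = s /\ expi x = expi y.
Proof.
move=> r0 s0 e.
have rs : r = s.
  have := congr1 (@normc R) e; rewrite !normcM !normc_expi !mulr1 /=.
  by rewrite expr0n /= !addr0 !sqrtr_sqr !gtr0_norm.
split=> //; move: e; rewrite rs; apply: mulfI.
by rewrite eq_complex /= gt_eqF.
Qed.

Lemma polar_Re_gt0 v : 0 < complex.Re v -> exists r, 0 < r /\
  v = r%:C * expi (atan (complex.Im v / complex.Re v)).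
Proof.
case: v => a b /= a0; set t := atan _.
have ct : 0 < cos t by apply: cos_gt0_pihalf; rewrite atan_gtNpi2 atan_ltpi2.
exists (a / cos t); split; first exact: divr_gt0.
have st : sin t = b / a * cos t.
  by rewrite -[b / a]atanK -/t /tan divfK// gt_eqF.
rewrite /expi st; apply/eqP; rewrite eq_complex /=.
by apply/andP; split; apply/eqP; field; rewrite !gt_eqF.
Qed.

(** The argument is the arctangent of [Im v / Re v], where [|Im v| < d] and [Re v > 1 - d], and
    [|atan x| <= |x|]. *)
Lemma polar_near1 (d : R) v : 0 < d < 1 -> normc (v - 1) < d -> exists r t,
  [/\ 0 < r, `|t| < d / (1 - d), `|t| < pi / 2 & v = r%:C * expi t].
Proof.
move=> /andP[d0 d1] vd.
have := le_lt_trans (@cnormRe _ (v - 1)) (vd : cnorm (v - 1 : R[i]^o) < d).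
have := le_lt_trans (@cnormIm _ (v - 1)) (vd : cnorm (v - 1 : R[i]^o) < d).
rewrite !raddfB /= subr0 => vI; rewrite ltr_norml => /andP[vR _].
have v0 : 0 < complex.Re v by lra.
have [r [r0 vE]] := polar_Re_gt0 v0.
exists r, (atan (complex.Im v / complex.Re v)); split=> //; last first.
  by rewrite ltr_norml atan_gtNpi2 atan_ltpi2.
apply: le_lt_trans (norm_atan_le _) _; rewrite normrM normfV (gtr0_norm v0).
by rewrite ltr_pM ?invr_ge0 ?(ltW v0)// ltf_pV2 ?posrE//; lra.
Qed.

Definition open_sector (p : nat) : set R[i] := [set z | exists r t,
  [/\ 0 < r, `|t| < pi / p%:R & z = r%:C * expi t]].

(** Two arguments in the open sector differ by less than [2 pi / p], so their multiples by [p] stay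
    within the range of [expi_inj]. *)
Lemma open_sector_exp_inj p z w : (0 < p)%N -> open_sector p z ->
  open_sector p w -> z ^+ p = w ^+ p -> z = w.
Proof.
move=> p0 [r [x [r0 xp ->]]] [s [y [s0 yp ->]]].
rewrite !exprMn -!rmorphXn !expiX => /polar_inj-[||rs xy]; rewrite ?exprn_gt0//.
have p0' : 0 < p%:R :> R by rewrite ltr0n.
have -> : r = s by apply/eqP; rewrite -(@eqrXn2 _ p) ?ltW//; exact/eqP.
have -> // : x = y.
apply: (@pmulrnI _ p p0); apply: expi_inj => //.
rewrite -mulrnBl normrMn.
apply: (@lt_le_trans _ _ ((pi / p%:R *+ 2) *+ p)).
  rewrite ltr_pMn2r// (le_lt_trans (ler_normB _ _))// mulr2n ltrD//.
by rewrite mulrnAC -(mulr_natr (pi / _)) divfK// gt_eqF.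
Qed.

Lemma pi_div_le2 p : (1 < p)%N -> pi / p%:R <= pi / 2 :> R.
Proof.
move=> p1; rewrite ler_wpM2l ?pi_ge0// lef_pV2 ?posrE ?ltr0n//; last exact: ltnW.
by rewrite ler_nat.
Qed.

Lemma nbhs_complexP z (S : set R[i]) : nbhs (z : R[i]^o) S <->
  exists2 e : R, 0 < e & forall w, normc (z - w) < e -> S w.
Proof.
split=> [/nbhs_ballP[e /= e0 h]|[e e0 h]].
  have eE : e = (complex.Re e)%:C by rewrite RRe_real// gtr0_real.
  exists (complex.Re e); first by rewrite -ltcR -eE.
  by move=> w zw; apply: h; rewrite -ball_normE /= eE ltcR.
apply/nbhs_ballP; exists e%:C; first by rewrite /= ltcR.
by move=> w; rewrite -ball_normE /= ltcR => zw; exact: h.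
Qed.

Lemma interior_sector p : (1 < p)%N ->
  interior (sector p : set R[i]^o) = open_sector p.
Proof.
move=> p1; have pi2 := pi_div_le2 p1; have pi0 := @pi_gt0 R.
have p0 : 0 < pi / p%:R :> R by rewrite divr_gt0// ltr0n ltnW.
apply/seteqP; split=> z; last first.
  move=> [r [t [r0 tp zE]]]; apply/nbhs_complexP.
  pose d0 := pi / p%:R - `|t|; have d00 : 0 < d0 by rewrite subr_gt0.
  (* Chosen so that [d / (1 - d) = d0]: a factor within [d] of 1 turns the argument by less than the
     room [d0] left in the sector. *)
  pose d := d0 / (1 + d0).
  have d01 : 0 < d < 1.
    by rewrite divr_gt0//= ?ltr_pdivrMr ?mul1r; lra.
  have dE : d / (1 - d) = d0 by rewrite /d; field; rewrite !gt_eqF//; lra.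
  exists (r * d); first by rewrite mulr_gt0//; case/andP: d01.
  move=> w zw.
  have nz : normc z = r.
    by rewrite zE normcM normc_expi mulr1 /= expr0n /= addr0 sqrtr_sqr gtr0_norm.
  have zN0 : z != 0.
    by apply: contraTneq r0 => z0; rewrite -nz z0 normc0 ltxx.
  have [|s [x [s0 xd _ wz]]] := @polar_near1 d (w / z) d01.
    rewrite -(divff zN0) -mulrBl normcM normcV nz ltr_pdivrMr//.
    by rewrite -normcN opprB mulrC.
  exists (r * s), (t + x); split; first by rewrite mulr_ge0// ltW.
    by rewrite (le_trans (ler_normD _ _))//; rewrite dE /d0 in xd; lra.
  rewrite -/(expi _) expiD -[LHS](divfK zN0) wz zE rmorphM /=.
  by rewrite mulrACA [s%:C * r%:C]mulrC [expi x * _]mulrC.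
move=> /[dup]/nbhs_singleton[r [t [r0 tp zE]]] /nbhs_complexP[e e0 h].
have {}zE : z = r%:C * expi t by [].
(* A neighbourhood of 0 contains [- (e / 2)], whereas points of the sector have nonnegative real
   part because [pi / p <= pi / 2]. *)
have rp : 0 < r.
  rewrite lt_neqAle r0 andbT eq_sym; apply/eqP => r00.
  have [|s [x [s0 xp]]] := h (- (e / 2))%:C.
    rewrite zE r00 mul0r sub0r normcN /= expr0n /= addr0 sqrtr_sqr normrN.
    by rewrite gtr0_norm; lra.
  move=> /(congr1 (@complex.Re R)) /=; rewrite mul0r subr0 => eq.
  have : 0 <= cos x.
    apply: cos_ge0_pihalf; rewrite -ler_norml; exact: le_trans pi2.
  by move=> /(mulr_ge0 s0); lra.
(* The factor [1 +i* (+- d)] moves [z] by only [d * r] but turns it by [+- atan d], so the turned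
   direction still belongs to the sector. *)
have rot (d : R) : 0 < d -> d * r < e -> forall b : bool,
    exists2 x, `|x| <= pi / p%:R & expi (t + (-1) ^+ b * atan d) = expi x.
  move=> d0 dre b; pose q : R[i] := 1 +i* ((-1) ^+ b * d).
  have [|u [u0 qE]] := @polar_Re_gt0 q; first by rewrite /=.
  have {}qE : q = u%:C * expi ((-1) ^+ b * atan d).
    rewrite {1}qE /= divr1; congr (_ * expi _).
    by case: b {q qE} => /=; rewrite ?expr0 ?expr1 ?mul1r// !mulN1r atanN.
  have [|s [x [s0 xp]]] := h (z * q).
    rewrite -[X in X - _]mulr1 -mulrBr normcM zE normcM normc_expi mulr1.
    rewrite /= expr0n /= addr0 sqrtr_sqr (gtr0_norm rp) subrr sub0r.
    by rewrite expr0n /= add0r sqrtr_sqr normrN normrM normr_sign mul1r gtr0_norm// mulrC.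
  rewrite -/(expi _) zE qE mulrACA -expiD -rmorphM /= => eq.
  have s1 : 0 < s.
    rewrite lt_neqAle s0 andbT eq_sym; apply: contraTneq (mulr_gt0 rp u0) => s00.
    move/(congr1 (@normc R)): eq; rewrite s00 mul0r normc0 normcM normc_expi.
    rewrite mulr1 /= expr0n /= addr0 sqrtr_sqr => /normr0_eq0 ->.
    by rewrite ltxx.
  by have [_ ?] := polar_inj (mulr_gt0 rp u0) s1 eq; exists x.
exists r, t; split=> //; rewrite lt_neqAle tp andbT; apply/eqP => tE.
pose d := e / (r + r).
have d0 : 0 < d by rewrite divr_gt0// addr_gt0.
have dr : d * r < e.
  by rewrite /d mulrAC ltr_pdivrMr ?addr_gt0// ltr_pM2l// ltrDl.
have at0 : 0 < atan d by rewrite -atan0 lt_atan.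
have at1 := @atan_ltpi2 R d.
(* On a boundary ray, [z] is turned outwards; by [expi_inj] the new angle equals [x], yet it exceeds
   [pi / p] in modulus. *)
have [t0|t0] := leP 0 t.
  have [x xp] := rot d d0 dr false; rewrite expr0 mul1r => eq.
  move: tE xp; rewrite (ger0_norm t0) ler_norml => tE /andP[x1 x2].
  have := @expi_inj (t + atan d) x _ eq; rewrite gtr0_norm; last lra.
  by rewrite mulr2n => H; have := H ltac:(lra); lra.
have [x xp] := rot d d0 dr true; rewrite expr1 mulN1r => eq.
move: tE xp; rewrite (ltr0_norm t0) ler_norml => tE /andP[x1 x2].
have := @expi_inj (t - atan d) x _ eq; rewrite ltr0_norm; last lra.
by rewrite mulr2n => H; have := H ltac:(lra); lra.
Qed.

End polar.

(** * Scalar iterates follow the principal root *)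

Lemma polar_neq0 (R : realType) (r t : R) : 0 < r -> r%:C * expi t != 0.
Proof.
move=> r0; apply: contraTneq r0 => /(congr1 (@normc R)).
rewrite normcM normc_expi mulr1 normc0 /= expr0n /= addr0 sqrtr_sqr.
by move/normr0_eq0 ->; rewrite ltxx.
Qed.

Lemma inv_ratio_le2 (F : realFieldType) (x : F) : 2 <= x -> x^-1 / (1 - x^-1) * x <= 2.
Proof.
move=> x2; have -> : x^-1 / (1 - x^-1) * x = x / (x - 1).
  by field; rewrite !gt_eqF//; lra.
by rewrite ler_pdivrMr; lra.
Qed.

(** Used with [d = pi]: it keeps differences of arguments within the range of [expi_inj]. *)
Lemma norm_sub_add_lt (F : realFieldType) (d x y z : F) : 2 <= d ->
  `|x| < d / 2 -> `|y| < d / 2 -> `|z| <= 2 -> `|x - (y + z)| < d *+ 2.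
Proof.
move=> d2; rewrite !ltr_norml ler_norml -[d *+ 2]mulr_natr.
by move=> /andP[? ?] /andP[? ?] /andP[? ?]; apply/andP; split; lra.
Qed.

Section scalar_newton.
Variables (R : realType) (p : nat).
Hypothesis p1 : (1 < p)%N.
Notation kappa := (p%:R^-1 : R[i]).
Let nC := complex_ring_norm R.

Let pN0 : p%:R != 0 :> R[i].
Proof. by rewrite pnatr_eq0 -lt0n ltnW. Qed.

Lemma invr_natC : kappa = (p%:R^-1 : R)%:C.
Proof. by rewrite fmorphV rmorph_nat. Qed.

Lemma mulrn_invr_natC : kappa *+ p = 1.
Proof. by rewrite -[LHS]mulr_natr mulVf. Qed.

Lemma cnorm_invr_nat : cnorm (kappa : R[i]^o) = p%:R^-1.
Proof. by rewrite invr_natC cnorm_real ger0_norm// invr_ge0. Qed.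

Let kC (x : R[i]) : kappa * x = x * kappa. Proof. exact: mulrC. Qed.
Let kN : cnorm (kappa : R[i]^o) <= p%:R^-1. Proof. by rewrite cnorm_invr_nat. Qed.

Let p2 : 2 <= p%:R :> R. Proof. by rewrite ler_nat. Qed.

Lemma disc1_Re_gt0 (e : R[i]) : normc e < 1 -> 0 < complex.Re (1 - e).
Proof.
move=> e1; have := le_lt_trans (@cnormRe _ e) (e1 : cnorm (e : R[i]^o) < 1).
by rewrite raddfB /= ltr_norml => /andP[_]; lra.
Qed.

Variable c : R[i].
Hypothesis c1 : normc c < 1.
Notation X := (newton_iter p kappa c).
Notation E := (residual p kappa c).

Let cX := newton_limit nC p1 kC mulrn_invr_natC kN c1.
Let E1 k : normc (E k) < 1.
Proof.
apply: le_lt_trans (residual_norm nC p1 kC mulrn_invr_natC kN c1 k) _.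
by rewrite exprn_ilt1 ?(rnorm_ge0 nC)// -lt0n expn_gt0.
Qed.

Let alpha (e : R[i]) : R := atan (complex.Im (1 - e) / complex.Re (1 - e)).

Let alpha_lt e : `|alpha e| < pi / 2.
Proof. by rewrite ltr_norml atan_gtNpi2 atan_ltpi2. Qed.

(** This is the argument of the invariant [X_k ^+ p * (1 - e_k) = 1 - c], free of multiples of
    [2 pi]: the factor of each step has argument [y] with [|p y| <= 2], and [alpha] stays below
    [pi / 2]. *)
Lemma newton_iter_polar k : exists r t, [/\ 0 < r, X k = r%:C * expi t
  & t *+ p = alpha c - alpha (E k)].
Proof.
have pi2 := @pi_ge2 R; have p2R := p2.
elim: k => [|k [r [t [r0 XE tE]]]] /=.
  by exists 1, 0; rewrite expi0 mulr1 mul0rn subrr.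
pose v := 1 - kappa * E k.
have v1 : normc (v - 1) < p%:R^-1.
  rewrite /v addrAC subrr add0r normcN normcM.
  rewrite (_ : normc kappa = p%:R^-1); last exact: cnorm_invr_nat.
  by rewrite gtr_pMr ?E1// invr_gt0; lra.
have p01 : 0 < (p%:R^-1 : R) < 1.
  by rewrite invr_gt0 invf_lt1; lra.
have [s [y [s0 yp _ vE]]] := polar_near1 p01 v1.
exists (r * s), (t + y); split; first exact: mulr_gt0.
  by rewrite XE -/v vE expiD rmorphM /= mulrACA.
rewrite mulrnDl tE.
suff -> : alpha (E k) = alpha (E k.+1) + y *+ p by rewrite /=; lra.
have := E1 k.+1; have := E1 k.
move=> /disc1_Re_gt0/polar_Re_gt0[q [q0 qE]].
move=> /disc1_Re_gt0/polar_Re_gt0[q' [q'0 q'E]].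
have [w [wE wx xw _]] := kappa_inverse nC p1 kN (ltW (E1 k)).
have step : (1 - E k.+1) * v ^+ p = 1 - E k.
  rewrite /= /residual_step wE opprB addrCA subrr addr0 mulrAC -exprMn.
  by rewrite wx expr1n mul1r.
have qs0 : 0 < q' * s ^+ p by rewrite mulr_gt0// exprn_gt0.
move: step; rewrite qE q'E vE exprMn -rmorphXn expiX mulrACA -rmorphM -expiD /=.
move=> /(polar_inj qs0 q0)[_ /esym]; apply: expi_inj.
have := alpha_lt (E k); have := alpha_lt (E k.+1); rewrite /alpha.
set a := atan _; set b := atan _ => a2 b2.
have yp2 : `|y *+ p| <= 2.
  rewrite normrMn -[leLHS]mulr_natr; apply: le_trans (ler_wpM2r (ler0n _ p) (ltW yp)) _.
  exact: inv_ratio_le2.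
exact: norm_sub_add_lt.
Qed.

(** The argument of the limit is read off from a late iterate: [p] times it equals [alpha c], which
    is below [pi / 2] in modulus. *)
Lemma newton_scalar_root : exists z, [/\
  rnorm_cvg (fun x : R[i] => cnorm (x : R[i]^o)) X z,
  z ^+ p = 1 - c & open_sector p z].
Proof.
have [z [Xz zp [C Ck]]] := cX; exists z; split=> //.
have pi2 := @pi_ge2 R; have p2R := p2.
have c0 := disc1_Re_gt0 c1; have [q [q0 qE]] := polar_Re_gt0 c0.
have z0 : z != 0.
  apply/eqP => z0; move: c0; rewrite -zp z0 expr0n.
  have -> : (p == 0)%N = false by rewrite gtn_eqF// ltnW.
  by rewrite /= ltxx.
have nz : 0 < normc z.
  rewrite lt_neqAle (@cnorm_ge0 _ R[i]^o z) andbT eq_sym.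
  by apply: contra z0 => /eqP/eq0_normc ->.
(* With this radius [d / (1 - d) = 1 / p], so [p] times the argument of [X k / z] is at most 1. If
   no iterate came that close, the distance from [X k] to [z] would never drop below
   [d * normc z]. *)
pose d : R := (p%:R + 1)^-1.
have d01 : 0 < d < 1 by rewrite invr_gt0 invf_lt1; lra.
have [k kd] : exists k, normc (X k / z - 1) < d.
  apply/not_existsP => h; move: Xz => [C' [q' [q01 h']]].
  suff : d * normc z <= 0 by rewrite pmulr_lle0// leNgt => /negP; apply; lra.
  apply: (le0_geometric q01 (C := C')) => n; apply: le_trans (h' n).
  have /negP := h n; rewrite -leNgt -(divff z0) -mulrBl normcM normcV.
  by rewrite ler_pdivlMr.
have [s [y [s0 yd _ vE]]] := polar_near1 d01 kd.
have [r [t [r0 XE tE]]] := newton_iter_polar k.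
have zE : z = (r / s)%:C * expi (t - y).
  have Xk0 : X k != 0 by rewrite XE polar_neq0.
  have -> : z = X k / (X k / z) by rewrite invf_div mulrCA divff ?mulr1.
  rewrite vE XE; apply: (mulIf (polar_neq0 y s0)).
  by rewrite divfK ?polar_neq0// mulrACA -rmorphM -expiD divfK ?gt_eqF// subrK.
have rs0 : 0 < r / s by rewrite divr_gt0.
have yp : `|y *+ p| <= 1.
  rewrite normrMn -[leLHS]mulr_natr; apply: le_trans (ler_wpM2r (ler0n _ p) (ltW yd)) _.
  have -> // : d / (1 - d) * p%:R = 1.
  by rewrite /d; field; rewrite !gt_eqF//; lra.
have typ : (t - y) *+ p = alpha c.
  move: zp; rewrite zE qE exprMn -rmorphXn expiX => /polar_inj-[]//.
    by rewrite exprn_gt0.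
  move=> _; apply: expi_inj.
  have -> : (t - y) *+ p - alpha c = 0 - (alpha (E k) + y *+ p).
    by rewrite mulrnBl tE; move: (y *+ p) => u; ring.
  apply: norm_sub_add_lt => //; last by rewrite (le_trans yp)// ler1n.
  by rewrite normr0 divr_gt0// pi_gt0.
exists (r / s), (t - y); split=> //.
rewrite ltr_pdivlMr; last lra.
rewrite mulr_natr -normrMn typ (lt_le_trans (alpha_lt c))//; lra.
Qed.

End scalar_newton.

(** * Spectral radius and empty spectra *)

(** Local bounds become uniform by compactness of the square [[-V, V]^2] of real coordinates, which
    contains the disc. *)
Lemma bounded_on_disc (R : realType) (V : R) (f : R[i] -> R) :
  (forall v0, exists2 e : R, 0 < e & exists M, forall v,
     normc (v - v0) < e -> normc v <= V -> f v <= M) ->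
  exists M, forall v, normc v <= V -> f v <= M.
Proof.
move=> floc.
have cK : compact (`[- V, V]%classic `*` `[- V, V]%classic : set (R * R)).
  by apply: compact_setX; exact: segment_compact.
have /compact_near_coveringP/(_ R (pinfty_nbhs R)
  (fun M st => normc (st.1 +i* st.2) <= V -> f (st.1 +i* st.2) <= M) _) := cK.
case=> [[s t] _|M [Mr MP]].
  have [e e0 [M fM]] := floc (s +i* t).
  exists ([set st : R * R | `|s - st.1| < e / 2 /\ `|t - st.2| < e / 2],
          [set i | M <= i]).
    split; last by exists M; split; [exact: num_real|move=> i /ltW].
    exists ([set x | `|s - x| < e / 2], [set x | `|t - x| < e / 2]) => //.
    have e20 : 0 < e / 2 by lra.
    by split; apply/nbhs_ballP; exists (e / 2) => // x; rewrite -ball_normE.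
  move=> [[a b] i] /= [[sa tb] Mi] abV; apply: le_trans Mi; apply: fM => //.
  have -> : (a +i* b) - (s +i* t) = (a - s)%:C + 'i * (b - t)%:C.
    by apply/eqP; rewrite eq_complex /=; apply/andP; split; apply/eqP; ring.
  rewrite (le_lt_trans (le_normcD _ _))// normcM.
  rewrite /= !expr0n !expr1n /= add0r !addr0 sqrtr1 mul1r !sqrtr_sqr.
  by rewrite distrC (distrC b); lra.
exists (M + 1) => -[a b] abV; apply: (MP (M + 1) _ (a, b)) => //=; first lra.
have := cnormRe (a +i* b); have := cnormIm (a +i* b).
have -> : cnorm (a +i* b : R[i]^o) = normc (a +i* b) by [].
rewrite !in_itv /= => h1 h2; move: (le_trans h1 abV) (le_trans h2 abV).
by rewrite !ler_norml => -> ->.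
Qed.

Section spectral_radius.
Variables (R : realType) (A : banachAlgType R[i]) (x : A) (V : R).
Hypothesis V0 : 0 < V.
Hypothesis xV : forall v : R[i], normc v <= V -> 1 - v *: x \is a GRing.unit.
Let nA := banach_ring_norm A.

Lemma resolventB (v w : R[i]) :
  1 - v *: x \is a GRing.unit -> 1 - w *: x \is a GRing.unit ->
  (1 - v *: x)^-1 - (1 - w *: x)^-1 =
  (v - w) *: ((1 - v *: x)^-1 * x * (1 - w *: x)^-1).
Proof.
move=> vU wU; rewrite scalerAl scalerAr.
have -> : (v - w) *: x = (1 - w *: x) - (1 - v *: x).
  by rewrite scalerBl opprB [RHS]addrC addrA subrK.
by rewrite mulrBr mulVr// mulrBl mul1r -mulrA mulrV// mulr1.
Qed.

(** Near [v0] the resolvent identity gives [|F| <= |F0| + |F| / 2], a local bound [2 |F0|]. A point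
    outside the disc has a neighbourhood that misses it. *)
Lemma resolvent_bound : exists M, forall v : R[i], normc v <= V ->
  cnorm (1 - v *: x)^-1 <= M.
Proof.
apply: bounded_on_disc => v0.
have [v0V|v0V] := leP (normc v0) V; last first.
  exists (normc v0 - V); first by rewrite subr_gt0.
  exists 0 => v vv0 vV; exfalso.
  have : normc v0 <= normc v + normc (v - v0).
    by rewrite -(normcN (v - v0)) opprB addrC -{1}(subrK v v0) le_normcD.
  by lra.
set F0 := (1 - v0 *: x)^-1.
have F00 : 0 <= cnorm F0 by exact: cnorm_ge0.
have x0 : 0 <= cnorm x by exact: cnorm_ge0.
have d0 : 0 < cnorm x * cnorm F0 * 2 + 1.
  by rewrite ltr_wpDl// !mulr_ge0.
exists (cnorm x * cnorm F0 * 2 + 1)^-1; first by rewrite invr_gt0.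
exists (cnorm F0 * 2) => v vv0 vV; set F := (1 - v *: x)^-1.
have FE : F = F0 + (v - v0) *: (F * x * F0).
  by rewrite -resolventB ?xV// addrCA subrr addr0.
have : cnorm F <= cnorm F0 + normc (v - v0) * (cnorm F * (cnorm x * cnorm F0)).
  rewrite {1}FE (le_trans (cnormD _ _))// lerD2l cnormZ.
  apply: ler_wpM2l; first exact: (@cnorm_ge0 _ R[i]^o).
  rewrite mulrA; apply: le_trans (rnormM nA _ _) _.
  by apply: ler_wpM2r => //; exact: rnormM.
have FF : 0 <= cnorm F by exact: cnorm_ge0.
have : normc (v - v0) * (cnorm F * (cnorm x * cnorm F0)) <= cnorm F / 2.
  rewrite mulrCA ler_wpM2l//.
  move: vv0; rewrite -[ltRHS]mul1r ltr_pdivlMr// mulrDr mulr1.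
  have : 0 <= normc (v - v0) by exact: (@cnorm_ge0 _ R[i]^o).
  by move: (normc _) => n; lra.
by lra.
Qed.

Lemma resolvent_equicontinuous : exists2 d : R, 0 < d & forall v w : R[i],
  normc v <= V -> normc w <= V -> normc (v - w) <= d ->
  cnorm ((1 - v *: x)^-1 - (1 - w *: x)^-1) <= 6^-1.
Proof.
have [M MP] := resolvent_bound.
have x0 : 0 <= cnorm x by exact: cnorm_ge0.
have M0 : 0 <= M.
  apply: le_trans (MP 0 _); first exact: cnorm_ge0.
  by rewrite normc0 ltW.
have d0 : 0 < (M * cnorm x * M + 1) * 6.
  by rewrite mulr_gt0// ltr_wpDl// !mulr_ge0.
exists ((M * cnorm x * M + 1) * 6)^-1; first by rewrite invr_gt0.
move=> v w vV wV; rewrite -[leRHS]mul1r ler_pdivlMr// => vw.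
set F := (1 - v *: x)^-1; set G := (1 - w *: x)^-1.
rewrite resolventB ?xV// -/F -/G.
rewrite cnormZ.
have FG : cnorm (F * x * G : A) <= M * cnorm x * M.
  apply: le_trans (rnormM nA _ _) _; apply: ler_pM; rewrite ?cnorm_ge0 ?MP//.
  by apply: le_trans (rnormM nA _ _) _; rewrite ler_wpM2r ?MP ?cnorm_ge0.
have n0 : 0 <= normc (v - w) by exact: (@cnorm_ge0 _ R[i]^o).
apply: (le_trans (ler_wpM2l n0 FG)).
by move: vw; move: (normc _) n0 (M * _ * M) => n n0 C; nra.
Qed.

(** By [(1 - y^2)^-1 = ((1 - y)^-1 + (1 + y)^-1) / 2], squaring averages the resolvents at [u] and
    [tau * u], where [tau ^+ (2 ^ j) = -1]. Rotations preserve distances, so the same [d] works for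
    every [j]. *)
Lemma averaged_resolvent_equicontinuous : exists2 d : R, 0 < d &
  forall j (v : R[i]), normc v <= V ->
    1 - (v *: x) ^+ (2 ^ j) \is a GRing.unit /\
    forall (w : R[i]), normc w <= V -> normc (v - w) <= d ->
    cnorm ((1 - (v *: x) ^+ (2 ^ j))^-1 - (1 - (w *: x) ^+ (2 ^ j))^-1) <= 6^-1.
Proof.
have [d d0 dP] := resolvent_equicontinuous; exists d => //.
elim=> [|j IH] v vV.
  by rewrite expr1; split=> [|w wV vw]; rewrite ?xV// expr1; exact: dP.
pose tau := expi (pi / (2 ^ j)%:R : R).
have tauj : tau ^+ (2 ^ j) = -1.
  rewrite expiX -[X in expi X]mulr_natr divfK ?pnatr_eq0 ?expn_eq0//.
  by rewrite /expi cospi sinpi; apply/eqP; rewrite eq_complex /= oppr0 !eqxx.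
have tauN u : normc (tau * u) = normc u by rewrite normcM normc_expi mul1r.
have tauE (u : R[i]) :
    1 - ((tau * u) *: x) ^+ (2 ^ j) = 1 + (u *: x) ^+ (2 ^ j).
  by rewrite -scalerA exprZn tauj scaleN1r opprK.
have avg u : normc u <= V -> 1 - (u *: x) ^+ (2 ^ j.+1) \is a GRing.unit /\
    (1 - (u *: x) ^+ (2 ^ j.+1))^-1 = (2^-1 : R[i]) *:
      ((1 - (u *: x) ^+ (2 ^ j))^-1 + (1 - ((tau * u) *: x) ^+ (2 ^ j))^-1).
  move=> uV; have [u1 _] := IH u uV.
  have [|u2 _] := IH (tau * u); first by rewrite tauN.
  move: u2; rewrite tauE expnS mulnC exprM; set y := (u *: x) ^+ (2 ^ j) in u1 * => u2.
  have cy : GRing.comm (1 - y) (1 + y).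
    by apply: commrD; [exact: commr1|apply: commr_sym; apply: commrB; [exact: commr1|]].
  have yE : 1 - y ^+ 2 = (1 - y) * (1 + y).
    by rewrite mulrDr mulr1 mulrBl mul1r expr2 addrA subrK.
  rewrite yE unitrM_comm// u1 u2; split=> //.
  apply: (mulrI (_ : (1 - y) * (1 + y) \is a GRing.unit)).
    by rewrite unitrM_comm// u1 u2.
  rewrite mulrV; last by rewrite unitrM_comm// u1 u2.
  rewrite -scalerAr mulrDr -[X in _ + X]mulrA mulrV// mulr1 cy -mulrA mulrV// mulr1.
  rewrite addrACA subrr addr0.
  have -> : (1 + 1 : A) = (2%:R : R[i]) *: 1 by rewrite scaler_nat.
  by rewrite scalerA mulVf ?scale1r// pnatr_eq0.
have [uV ->] := avg v vV; split=> // w wV vw.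
have [_ ->] := avg w wV; rewrite -scalerBr opprD addrACA cnormZ.
have -> : cnorm (2^-1 : R[i]^o) = 2^-1.
  by rewrite (_ : 2^-1 = (2^-1 : R)%:C) ?cnorm_real ?ger0_norm// fmorphV rmorph_nat.
have [_ /(_ w wV vw) h1] := IH v vV.
have [|_ /(_ (tau * w)) h2] := IH (tau * v); first by rewrite tauN.
have {}h2 := h2 _ _; rewrite !tauN -mulrBr tauN in h2; have {}h2 := h2 wV vw.
rewrite mulrC ler_pdivrMr// (le_trans (cnormD _ _))//.
by apply: le_trans (lerD h1 h2) _; lra.
Qed.

(* Rickart's elementary route to the spectral radius formula: the average of
   [(1 - u x)^-1] over the circle [|u| = s] is [(1 - (s x)^n)^-1] with n a power
   of 2, so it is close to 1 for large n iff [(s x)^n] tends to 0; by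
   equicontinuity in s this property propagates from s = 0 up to s = V. *)
Lemma spectral_radius_pow :
  exists n, (0 < n)%N /\ V ^+ n * cnorm (x ^+ n) <= 2^-1.
Proof.
have [d d0 dP] := averaged_resolvent_equicontinuous.
pose s m : R := Num.min (m%:R * d) V.
have s0 m : 0 <= s m by rewrite le_min (ltW V0) andbT mulr_ge0// ltW.
have sN m : normc (s m)%:C = s m.
  by rewrite /= expr0n /= addr0 sqrtr_sqr ger0_norm.
have sV m : normc (s m)%:C <= V by rewrite sN ge_min lexx orbT.
have step m : normc ((s m)%:C - (s m.+1)%:C) <= d.
  rewrite -rmorphB /= expr0n /= addr0 sqrtr_sqr /s -natr1 mulrDl mul1r.
  rewrite ler_norml; case: (leP (m%:R * d) V) => h1; case: (leP (m%:R * d + d) V) => h2;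
  by apply/andP; split; lra.
have claim m : exists j, cnorm (((s m)%:C *: x) ^+ (2 ^ j)) <= 2^-1.
  elim: m => [|m [j IH]].
    exists 0%N; rewrite /s mul0r (min_idPl (ltW V0)) scale0r expr1 cnorm0.
    by rewrite invr_ge0.
  (* Squaring twice turns [1/2] into [1/16 <= 1/7]; then [|F - 1| <= 1/6], by equicontinuity
     [|G - 1| <= 1/3], and so [|z| <= 1/2]. *)
  exists j.+2; set i := j.+2.
  have [] := dP i _ (sV m); set y := (_ *: x) ^+ _ => yU.
  move=> /(_ _ (sV m.+1) (step m)); have [] := dP i _ (sV m.+1).
  set z := (_ *: x) ^+ _ => zU _ yz.
  have y7 : cnorm y <= 7^-1.
    rewrite /y /i !expnS mulnA mulnC exprM; apply: le_trans (rnormX nA _ _) _.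
    apply: le_trans (_ : (2^-1) ^+ (2 * 2) <= _).
      by apply: lerXn2r; rewrite ?nnegrE ?cnorm_ge0 ?invr_ge0.
    by rewrite !exprS expr0; lra.
  set F := (1 - y)^-1 in yz; set G := (1 - z)^-1 in yz.
  have n1 := rnorm1 nA.
  have FE : F - 1 = y * F.
    by rewrite -[X in _ - X](mulrV yU) mulrBl mul1r opprB addrCA subrr addr0.
  have F1 : cnorm (F - 1) <= 6^-1.
    have : cnorm (F - 1) <= cnorm y * (cnorm (F - 1) + 1).
      rewrite {1}FE (le_trans (rnormM nA _ _))// ler_wpM2l ?cnorm_ge0//.
      by rewrite -{1}(subrK 1 F) (le_trans (cnormD _ _))// lerD2l.
    have : 0 <= cnorm (F - 1) by exact: cnorm_ge0.
    move: y7; move: (cnorm y) (cnorm _) => a b; nra.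
  have G1 : cnorm (G - 1) <= 3^-1.
    rewrite -(subrK F G) -addrA (le_trans (cnormD _ _))//.
    by rewrite -cnormN opprB; lra.
  have zE : z = (G - 1) * (1 - z).
    by rewrite mulrBl mulVr// mul1r opprB addrCA subrr addr0.
  have : cnorm z <= cnorm (G - 1) * (1 + cnorm z).
    rewrite {1}zE (le_trans (rnormM nA _ _))// ler_wpM2l ?cnorm_ge0//.
    by rewrite (le_trans (cnormD _ _))// cnormN lerD2r.
  have : 0 <= cnorm z by exact: cnorm_ge0.
  move: G1; move: (cnorm (G - 1)) (cnorm z) => a b; nra.
have [m mV] : exists m : nat, V <= m%:R * d.
  exists (Num.bound (V / d)); rewrite -ler_pdivrMr//.
  by apply/ltW/archi_boundP; rewrite divr_ge0// ltW.
have [j] := claim m; rewrite /s (min_idPr mV) exprZn cnormZ => h.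
exists (2 ^ j)%N; split; first by rewrite expn_gt0.
move: h; rewrite -rmorphXn cnorm_real ger0_norm// exprn_ge0// ltW//.
Qed.

End spectral_radius.

(** * Empty spectrum in a corner algebra *)

Section idempotent.
Variables (R : realType) (A : banachAlgType R[i]) (e r : A).
Hypothesis ee : e * e = e.
Hypothesis er : GRing.comm e r.
Hypothesis rU : r \is a GRing.unit.
Hypothesis resolvent : forall v : R[i], exists y,
  [/\ y \is a GRing.unit, GRing.comm e y & y * e = (1 - v *: r) * e].

(* The hypotheses say that the spectrum of [r e] in the corner algebra with unit
   [e] is empty. *)
Lemma idempotent_eq0_of_empty_spectrum : e = 0.
Proof.
have nA := banach_ring_norm A.
have unit_re v : 1 - v *: (r * e) \is a GRing.unit.
  have [y [yU ey yE]] := resolvent v.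
  have eVy : GRing.comm e y^-1 by exact: commrV.
  have -> : 1 - v *: (r * e) = (1 - e) + y * e.
    by rewrite yE mulrBl mul1r addrA subrK scalerAl.
  have e0 : e * (1 - e) = 0 by rewrite mulrBr mulr1 ee subrr.
  have e0' : (1 - e) * e = 0 by rewrite mulrBl mul1r ee subrr.
  have ie : (1 - e) * (1 - e) = 1 - e by rewrite mulrBl mul1r e0 subr0.
  (* Elements [(1 - e) + u * e] multiply as the [u * e] do in the corner, so [y^-1] yields the
     inverse. *)
  have prod u w : GRing.comm e u -> GRing.comm e w ->
      ((1 - e) + u * e) * ((1 - e) + w * e) = (1 - e) + (u * w) * e.
    move=> eu ew; move: (1 - e) e0 e0' ie => f e0 e0' ie.
    rewrite mulrDl !mulrDr ie -ew (mulrA f) e0' mul0r addr0.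
    by rewrite -(mulrA u e f) e0 mulr0 add0r -(mulrA u e) (mulrA e e w) ee ew mulrA.
  apply/unitrP; exists ((1 - e) + y^-1 * e).
  by rewrite !prod// mulVr// mulrV// mul1r subrK.
(* The radius exceeds [|r^-1|], so writing [e = (r e)^n r^(-n) e] gives [|e| <= |e| / 2]. *)
have [||n [n0 nV]] := @spectral_radius_pow _ _ (r * e) (cnorm r^-1 + 1).
- by rewrite ltr_wpDl ?cnorm_ge0.
- by move=> v _; exact: unit_re.
have en : e ^+ n = e.
  by case: n n0 {nV} => // n _; elim: n => [//|n IH]; rewrite exprS IH ee.
have eE : e = (r * e) ^+ n * r^-1 ^+ n * e.
  rewrite exprMn_comm; last exact: commr_sym.
  have ern : GRing.comm e (r^-1 ^+ n) by apply/commrX/commrV.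
  rewrite en -(mulrA (r ^+ n)) ern mulrA -(mulrA _ e e) ee -exprMn_comm.
    by rewrite mulrV// expr1n mul1r.
  by rewrite /GRing.comm mulrV// mulVr.
apply: (rnorm_le0 nA).
have e0 : 0 <= cnorm e by exact: cnorm_ge0.
suff : cnorm e <= 2^-1 * cnorm e by lra.
rewrite {1}eE; apply: le_trans (rnormM nA _ _) _; rewrite ler_wpM2r//.
apply: le_trans (rnormM nA _ _) _; apply: le_trans nV; rewrite mulrC.
rewrite ler_wpM2r ?cnorm_ge0//; apply: le_trans (rnormX nA _ _) _.
by apply: lerXn2r; rewrite ?nnegrE ?addr_ge0 ?cnorm_ge0// lerDl.
Qed.

End idempotent.

(** * Numerical range and Hahn-Banach *)

Section hahn_banach.
Variables (R : realType) (V : lmodType R[i]).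
Implicit Types (p q : V -> R) (x y : V) (s t : R).

(** The complex space is regarded as a real one: only positive real scalars enter. *)
Definition sublinear p := (forall x y, p (x + y) <= p x + p y) /\
  (forall t x, 0 < t -> p (t%:C *: x) = t * p x).

Lemma sublinear0 p : sublinear p -> p 0 = 0.
Proof.
by move=> [_ /(_ 2 0 ltac:(lra))]; rewrite scaler0; lra.
Qed.

Lemma sublinear_geN p x : sublinear p -> - p (- x) <= p x.
Proof.
move=> sp; have := sp.1 x (- x); rewrite subrr (sublinear0 sp); lra.
Qed.

Lemma inf_le_add (S S1 S2 : set R) : S1 !=set0 -> S2 !=set0 ->
  (forall u v, S1 u -> S2 v -> inf S <= u + v) -> inf S <= inf S1 + inf S2.
Proof.
move=> S10 S20 h; rewrite -lerBlDr; apply: lb_le_inf => // u Su.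
rewrite lerBlDr -lerBlDl; apply: lb_le_inf => // v Sv.
by rewrite lerBlDl h.
Qed.

(* A sublinear minorant of [p]; if [p] is minimal the two agree, which makes [p]
   additive. *)
Definition sublinear_shift p y x : R :=
  inf [set p (x + t%:C *: y) - t * p y | t in [set t | 0 <= t]].

Section shift.
Variables (p : V -> R) (y : V).
Hypothesis sp : sublinear p.

Lemma sublinear_shift_le t x : 0 <= t ->
  sublinear_shift p y x <= p (x + t%:C *: y) - t * p y.
Proof.
move=> t0; apply: ge_inf; last by exists t.
(* A lower bound of the set, so that [inf] is not a default value. *)
exists (- p (- x)) => _ [s s0 <-].
have [->|sN0] := eqVneq s 0.
  by rewrite scale0r addr0 mul0r subr0 sublinear_geN.
have sp0 : 0 < s by rewrite lt_neqAle eq_sym sN0.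
rewrite -(sp.2 _ _ sp0); have := sp.1 (- x) (x + s%:C *: y).
by rewrite addKr; lra.
Qed.

Let shift_neq0 x : [set p (x + t%:C *: y) - t * p y | t in [set t | 0 <= t]] !=set0.
Proof. by exists (p (x + 0%:C *: y) - 0 * p y), 0 => /=. Qed.

Lemma sublinear_shift_le0 x : sublinear_shift p y x <= p x.
Proof.
have := sublinear_shift_le x (lexx 0).
by rewrite scale0r addr0 mul0r subr0.
Qed.

Lemma sublinear_shift_sublinear : sublinear (sublinear_shift p y).
Proof.
have homle t x : 0 < t ->
    sublinear_shift p y (t%:C *: x) <= t * sublinear_shift p y x.
  move=> t0; rewrite mulrC -ler_pdivrMr//; apply: lb_le_inf => // _ [s /= s0 <-].
  rewrite ler_pdivrMr//.
  apply: le_trans (sublinear_shift_le _ (mulr_ge0 (ltW t0) s0)) _.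
  by rewrite rmorphM /= -scalerA -scalerDr sp.2//; lra.
split=> [x x'|t x t0].
  apply: inf_le_add => // _ _ [s /= s0 <-] [t /= t0 <-].
  apply: le_trans (sublinear_shift_le _ (addr_ge0 s0 t0)) _.
  rewrite rmorphD /= scalerDl addrACA.
  by have := sp.1 (x + s%:C *: y) (x' + t%:C *: y); lra.
apply/eqP; rewrite eq_le homle//= mulrC -ler_pdivlMr//.
have tV : 0 < t^-1 by rewrite invr_gt0.
have := homle t^-1 (t%:C *: x) tV.
by rewrite scalerA -rmorphM /= mulVf ?gt_eqF// scale1r mulrC.
Qed.

End shift.

(** Zorn's lemma for the reversed pointwise order; a nonempty chain is bounded by its pointwise
    infimum, subadditive because one of any two members lies below the other. *)
Lemma minimal_sublinear q : sublinear q -> exists p,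
  [/\ sublinear p, forall x, p x <= q x &
      forall p', sublinear p' -> (forall x, p' x <= p x) -> forall x, p x <= p' x].
Proof.
move=> sq; pose T := {p : V -> R | sublinear p /\ forall x, p x <= q x}.
pose q0 : T := exist _ q (conj sq (fun=> lexx _)).
have [||C Ctot|[p [sp pq]] pmin] := ZL_preorder q0
  (R := fun p p' : T => `[< forall x, sval p' x <= sval p x >]).
- by move=> p; apply/asboolP.
- move=> p p' p'' /asboolP h1 /asboolP h2; apply/asboolP => x.
  exact: le_trans (h2 x) (h1 x).
- have [C0|/set0P[c0 Cc0]] := eqVneq C set0; first by exists q0 => s; rewrite C0.
  pose m x := inf [set sval c x | c in C].
  have mn x : [set sval c x | c in C] !=set0 by exists (sval c0 x), c0.
  have mle c x : C c -> m x <= sval c x.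
    move=> Cc; apply: ge_inf; last by exists c.
    exists (- q (- x)) => _ [[d [sd dq]] _ <-] /=.
    by apply: le_trans (sublinear_geN x sd); rewrite lerN2.
  have homle t x : 0 < t -> m (t%:C *: x) <= t * m x.
    move=> t0; rewrite mulrC -ler_pdivrMr//; apply: lb_le_inf => // _ [c Cc <-].
    rewrite ler_pdivrMr//; apply: le_trans (mle c _ Cc) _.
    by rewrite (svalP c).1.2// mulrC.
  have sm : sublinear m.
    split=> [x y|t x t0].
      apply: inf_le_add => // _ _ [c Cc <-] [d Cd <-].
      have [/asboolP cd|/asboolP dc] := Ctot c d Cc Cd.
        apply: le_trans (mle d _ Cd) _; apply: le_trans ((svalP d).1.1 _ _) _.
        by rewrite lerD2r.
      apply: le_trans (mle c _ Cc) _; apply: le_trans ((svalP c).1.1 _ _) _.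
      by rewrite lerD2l.
    apply/eqP; rewrite eq_le homle//= mulrC -ler_pdivlMr//.
    have tV : 0 < t^-1 by rewrite invr_gt0.
    have := homle t^-1 (t%:C *: x) tV.
    by rewrite scalerA -rmorphM /= mulVf ?gt_eqF// scale1r mulrC.
  have mq x : m x <= q x by apply: le_trans (mle c0 _ Cc0) _; exact: (svalP c0).2.
  by exists (exist _ m (conj sm mq)) => c Cc; apply/asboolP => x; exact: mle.
exists p; split=> // p' sp' p'p x.
have p'q y : p' y <= q y by exact: le_trans (p'p y) (pq y).
have /asboolP := pmin (exist _ p' (conj sp' p'q)) (introT (asboolP _) p'p).
exact.
Qed.

(** A minimal [g] lies below its own shift by [y], so [g x <= g (x + y) - g y], and [g] is
    additive. *)
Lemma hahn_banach q : sublinear q -> exists g : V -> R,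
  [/\ forall x y, g (x + y) = g x + g y,
      forall t x, g (t%:C *: x) = t * g x & forall x, g x <= q x].
Proof.
move=> /minimal_sublinear[g [sg gq gmin]]; exists g.
have gD x y : g (x + y) = g x + g y.
  apply/eqP; rewrite eq_le sg.1 /= -lerBrDr.
  have := gmin _ (sublinear_shift_sublinear y sg) (sublinear_shift_le0 y sg) x.
  move=> /le_trans; apply; have := sublinear_shift_le y sg x (@ler01 R).
  by rewrite scale1r mul1r.
split=> // t x; have [t0|t0|<-] := ltgtP 0 t; first exact: sg.2.
  have gN z : g (- z) = - g z.
    by apply/eqP; rewrite -addr_eq0 -gD addNr (sublinear0 sg).
  rewrite -[t%:C *: x]opprK -scaleNr -rmorphN gN sg.2 ?oppr_gt0//=.
  by rewrite mulNr opprK.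
by rewrite scale0r mul0r (sublinear0 sg).
Qed.

End hahn_banach.


(** * States obtained from the slope of the norm at the identity *)

Section accretive.
Variables (R : realType) (A : banachAlgType R[i]).
Let nA := banach_ring_norm A.
Implicit Types x y : A.

(* For small [t] the quotient tends to the largest real part of the numerical
   range of [x]; its infimum over [t] is already that limit. *)
Definition norm_slope x : R :=
  inf [set (cnorm (1 + t%:C *: x) - 1) / t | t in [set t : R | 0 < t]].

Let scaleN x (t : R) : 0 <= t -> cnorm (t%:C *: x) = t * cnorm x.
Proof. by move=> t0; rewrite cnormZ cnorm_real ger0_norm. Qed.

Let cnorm1A : cnorm (1 : A) = 1.
Proof. by rewrite /cnorm banach_norm1. Qed.

Lemma norm_slope_le (t : R) x : 0 < t -> norm_slope x <= (cnorm (1 + t%:C *: x) - 1) / t.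
Proof.
move=> t0; apply: ge_inf; last by exists t.
exists (- cnorm x) => _ [s /= s0 <-]; rewrite ler_pdivlMr//.
have := cnormD (1 + s%:C *: x) (- (s%:C *: x)).
by rewrite addrK cnormN scaleN ?(ltW s0)// cnorm1A; lra.
Qed.

Let slope_neq0 x : [set (cnorm (1 + t%:C *: x) - 1) / t | t in [set t : R | 0 < t]] !=set0.
Proof. by exists ((cnorm (1 + 1%:C *: x) - 1) / 1), 1 => /=. Qed.

Lemma norm_slope_sublinear : sublinear norm_slope.
Proof.
have homle (t : R) x : 0 < t -> norm_slope (t%:C *: x) <= t * norm_slope x.
  move=> t0; rewrite mulrC -ler_pdivrMr//; apply: lb_le_inf => // _ [s /= s0 <-].
  rewrite ler_pdivrMr//.
  have := norm_slope_le (t%:C *: x) (divr_gt0 s0 t0).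
  rewrite scalerA -rmorphM /= divfK ?gt_eqF// => /le_trans; apply.
  by rewrite invf_div mulrCA mulrC.
split=> [x y|t x t0].
  apply: inf_le_add => // _ _ [s /= s0 <-] [t /= t0 <-].
  have st : 0 < s + t by exact: addr_gt0.
  (* At this parameter [1 + u (x + y)] is the convex combination of [1 + s x] and [1 + t y] with
     weights [t / (s + t)] and [s / (s + t)]. *)
  have u0 : 0 < s * t / (s + t) by rewrite divr_gt0// mulr_gt0.
  apply: le_trans (norm_slope_le (x + y) u0) _.
  rewrite ler_pdivrMr//.
  have -> : 1 + (s * t / (s + t))%:C *: (x + y) =
      (t / (s + t))%:C *: (1 + s%:C *: x) + (s / (s + t))%:C *: (1 + t%:C *: y).
    rewrite scalerDr (scalerDr _ 1 (s%:C *: x)) (scalerDr _ 1 (t%:C *: y)) addrACA -scalerDl.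
    rewrite !scalerA -!rmorphM -rmorphD /= -mulrDl [t + s]addrC divff ?gt_eqF// scale1r.
    by congr (_ + (_%:C *: _ + _%:C *: _)); field; rewrite gt_eqF.
  have := cnormD ((t / (s + t))%:C *: (1 + s%:C *: x))
    ((s / (s + t))%:C *: (1 + t%:C *: y)).
  rewrite !scaleN ?divr_ge0 ?(ltW s0) ?(ltW t0) ?(ltW st)//.
  move: (cnorm (1 + s%:C *: x)) (cnorm (1 + t%:C *: y)) (cnorm _) => a b c abc.
  have -> : ((a - 1) / s + (b - 1) / t) * (s * t / (s + t)) =
      t / (s + t) * a + s / (s + t) * b - 1.
    by field; rewrite !gt_eqF.
  by rewrite lerD2r.
apply/eqP; rewrite eq_le homle//= mulrC -ler_pdivlMr//.
have tV : 0 < t^-1 by rewrite invr_gt0.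
have := homle t^-1 (t%:C *: x) tV.
by rewrite scalerA -rmorphM /= mulVf ?gt_eqF// scale1r mulrC.
Qed.

Lemma norm_slope_le_norm x : norm_slope x <= cnorm x.
Proof.
apply: le_trans (norm_slope_le x ltr01) _; rewrite divr1 scale1r.
by have := cnormD (1 : A) x; rewrite cnorm1A; lra.
Qed.

Lemma norm_slopeN1 : norm_slope (-1) <= -1.
Proof.
apply: le_trans (norm_slope_le _ ltr01) _; rewrite divr1 scale1r subrr.
by rewrite cnorm0 sub0r.
Qed.

Section state_of_real_functional.
Variable g : A -> R.
Hypothesis gD : forall x y, g (x + y) = g x + g y.
Hypothesis gZ : forall (t : R) x, g (t%:C *: x) = t * g x.
Hypothesis gle : forall x, g x <= norm_slope x.

Definition complexify x : R[i] := g x -i* g ('i *: x).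

Lemma complexify_linear : linear complexify.
Proof.
have gN x : g (- x) = - g x.
  by rewrite -scaleN1r (_ : -1 = (-1)%:C) ?gZ ?mulN1r// rmorphN1.
have gC (c : R[i]) x : g (c *: x) =
    complex.Re c * g x + complex.Im c * g ('i *: x).
  by rewrite {1}[c]complexE (mulrC 'i%C) scalerDl gD -scalerA !gZ.
move=> c x y.
have gi : g ('i *: (c *: x)) = complex.Re c * g ('i *: x) - complex.Im c * g x.
  by rewrite scalerA (mulrC 'i%C) -scalerA (gC c) scalerA -expr2 sqr_i scaleN1r gN mulrN.
rewrite /complexify scalerDr !gD (gC c x) gi.
apply/eqP; rewrite eq_complex; case: c gi => a b _ /=.
by apply/andP; split; apply/eqP; ring.
Qed.

Let f : {linear A -> R[i]^o} := HB.pack (complexify : A -> R[i]^o)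
  (GRing.isLinear.Build R[i] A R[i]^o *:%R complexify complexify_linear).

Let fE x : f x = complexify x. Proof. by []. Qed.

Lemma complexify_norm x : normc (complexify x) <= cnorm x.
Proof.
have Re_le y : complex.Re (f y) <= cnorm y.
  by rewrite fE /= (le_trans (gle y))// norm_slope_le_norm.
rewrite -fE; have [->|f0] := eqVneq (f x) 0.
  by rewrite normc0 cnorm_ge0.
have n0 : 0 < normc (f x).
  rewrite lt_neqAle (@cnorm_ge0 _ R[i]^o (f x)) andbT eq_sym.
  by apply: contra f0 => /eqP/eq0_normc ->.
(* The rotation that makes [f (u *: x)] real and nonnegative, so that the bound on real parts
   applies. *)
pose u : R[i] := (normc (f x))%:C / f x.
have uN : normc u = 1.
  by rewrite normcM normcV /= expr0n /= addr0 sqrtr_sqr gtr0_norm// divff ?gt_eqF.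
have uf : f (u *: x) = (normc (f x))%:C.
  by rewrite linearZ /= -[_ *: _]/(u * f x) divfK.
have := Re_le (u *: x); rewrite uf cnormZ.
by have -> : cnorm (u : R[i]^o) = 1; [exact: uN|rewrite mul1r].
Qed.

(** The slopes at 1 and -1 force [g 1 = 1]; then [|f 1| <= 1] leaves no room for an imaginary
    part. *)
Lemma complexify_state : states f.
Proof.
have g1 : g 1 = 1.
  apply/eqP; rewrite eq_le; apply/andP; split.
    by rewrite (le_trans (gle 1))// (le_trans (norm_slope_le_norm 1))// cnorm1A.
  have := le_trans (gle (-1)) norm_slopeN1.
  by have := gD 1 (-1); rewrite subrr -(scale0r (0 : A)) (gZ 0 0) mul0r; lra.
have f1 : f 1 = 1.
  have := complexify_norm 1; rewrite cnorm1A fE /complexify g1 /= => h.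
  have : 1 + (- g ('i *: 1)) ^+ 2 <= 1.
    rewrite -[leRHS](expr1n _ 2) -ler_sqrt ?exprn_gt0// expr1n.
    by rewrite sqrtr1 -{1}(expr1n _ 2).
  rewrite gerDl => h2; have : (- g ('i *: 1)) ^+ 2 = 0.
    by apply/eqP; rewrite eq_le h2 sqr_ge0.
  by move/eqP; rewrite sqrf_eq0 => /eqP ->.
split=> //.
- move=> x; apply/cvgrPdist_lt => e e0; near=> y.
  rewrite -linearB.
  apply: (@le_lt_trans _ _ `|x - y|); last by near: y; exact: cvgr_dist_lt.
  by rewrite [leRHS]cnormE lecR complexify_norm.
- apply/eqP; rewrite eq_le; apply/andP; split.
    apply: ge_sup; first by exists (complex.Re `|f 0|), 0 => //=; rewrite normr0.
    move=> _ [x /= x1 <-]; apply: le_trans (complexify_norm x) _.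
    by rewrite cnorm_leC.
  apply: ub_le_sup; last first.
    by exists 1; [rewrite /= cnormE cnorm1A|rewrite f1 normr1].
  exists 1 => _ [x /= x1 <-]; apply: le_trans (complexify_norm x) _.
  by rewrite cnorm_leC.
Unshelve. all: by end_near. Qed.

End state_of_real_functional.

(** If there were no such [t], the slope at [- x] would be nonnegative, and some state would have
    nonpositive real part at [x]. *)
Lemma strictly_accretive_slope x : strictly_accretive x ->
  exists2 t : R, 0 < t & cnorm (1 - t%:C *: x) < 1.
Proof.
move=> xacc; apply/not_exists2P => h.
have slope0 : 0 <= norm_slope (- x).
  apply: lb_le_inf => // _ [t /= t0 <-]; rewrite divr_ge0 ?(ltW t0)// subr_ge0.
  by case: (h t) => //; rewrite scalerN => /negP; rewrite -leNgt.
(* Dominating by the shift along [- x] gives, at parameter 1, [g x <= - norm_slope (- x)]. *)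
have [g [gD gZ gle]] := hahn_banach (sublinear_shift_sublinear (- x) norm_slope_sublinear).
have gle' y : g y <= norm_slope y.
  by apply: le_trans (gle y) _; exact: sublinear_shift_le0 norm_slope_sublinear _.
have /xacc /= : numerical_range x (complexify g x).
  by eexists; [exact: (complexify_state gD gZ gle')|].
have := le_trans (gle x) (sublinear_shift_le (- x) norm_slope_sublinear x (@ler01 R)).
by rewrite scale1r subrr mul1r (sublinear0 norm_slope_sublinear) /=; lra.
Qed.

Lemma accretive_norm_lt1 x : strictly_accretive x -> `|1 - 2%:R * x| <= 1 ->
  `|1 - x| < 1.
Proof.
move=> /strictly_accretive_slope[t t0 t1].
rewrite -(rmorph1 (real_complex R)) -cnorm_leC -cnorm_ltC.
rewrite mulr_natl -scaler_nat (_ : 2%:R = 2%:C); last first.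
  by rewrite rmorph_nat.
move=> x2.
have conv (a : R) (y z : A) : 0 < a <= 1 -> cnorm y < 1 -> cnorm z <= 1 ->
    cnorm (a%:C *: y + (1 - a)%:C *: z) < 1.
  move=> /andP[a0 a1] y1 z1; apply: le_lt_trans (cnormD _ _) _.
  by rewrite !scaleN ?(ltW a0) ?subr_ge0//; nra.
have comb (a s : R) : a * t + (1 - a) * s = 1 ->
    1 - x = a%:C *: (1 - t%:C *: x) + (1 - a)%:C *: (1 - s%:C *: x).
  move=> e; rewrite !scalerBr addrACA -opprD !scalerA -!scalerDl -!rmorphM -!rmorphD /= e.
  by rewrite addrCA subrr addr0 !scale1r.
(* The element [1 - x] lies between [1 - t x] and [1 - 2 x] if [t <= 1], and between [1 - t x] and 1
   otherwise; the weight [a] of [1 - t x] solves [a t + (1 - a) s = 1] with [s] equal to 2 or 0. *)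
have [tle|tgt] := leP t 1.
  have h : 0 < (2 - t)^-1 <= 1 by rewrite invr_gt0 invf_le1; lra.
  by rewrite (comb (2 - t)^-1 2); [exact: conv|field; rewrite gt_eqF//; lra].
have h : 0 < t^-1 <= 1 by rewrite invr_gt0 invf_le1; lra.
rewrite (comb t^-1 0); last by field; rewrite gt_eqF.
by apply: conv => //; rewrite scale0r subr0 cnorm1A.
Qed.

End accretive.

(** * Principal roots *)

Section principal_root.
Variables (R : realType) (A : banachAlgType R[i]) (p : nat).
Hypothesis p1 : (1 < p)%N.
Let nA := banach_ring_norm A.
Implicit Types (a b r s x y : A) (z c : R[i]).

Let p0 : (0 < p)%N. Proof. exact: ltnW. Qed.

Notation kappa := ((p%:R^-1 : R[i])%:A : A).

Let kappaC x : kappa * x = x * kappa.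
Proof. by rewrite -scalerAl mul1r -scalerAr mulr1. Qed.

Let kappap : kappa *+ p = 1.
Proof. by rewrite scalerMnl mulrn_invr_natC// scale1r. Qed.

Let kappaN : cnorm kappa <= p%:R^-1.
Proof. by rewrite cnorm_alg cnorm_invr_nat. Qed.

Lemma neumann_unit x : cnorm x < 1 -> 1 - x \is a GRing.unit.
Proof.
by move=> /(neumann nA)[w [wx xw _]]; apply/unitrP; exists w.
Qed.

Lemma alg_sub_unit c x : cnorm x < normc c -> c%:A - x \is a GRing.unit.
Proof.
move=> xc.
have c0 : c != 0.
  by apply: contraTneq xc => ->; rewrite normc0 -leNgt cnorm_ge0.
have -> : c%:A - x = c *: (1 - c^-1 *: x).
  by rewrite scalerBr scalerA divff// scale1r.
rewrite scaler_unit ?unitfE//; apply: neumann_unit.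
rewrite cnormZ (_ : cnorm (c^-1 : R[i]^o) = (normc c)^-1); last exact: normcV.
by rewrite mulrC ltr_pdivrMr ?mul1r// (le_lt_trans _ xc)// cnorm_ge0.
Qed.

(** One inclusion of polynomial spectral mapping: ['X - z%:P] divides [P], and commuting factors of
    a unit are units. *)
Lemma alg_sub_unit_of_root (P : {poly R[i]}) x z : root P z ->
  horner_alg x P \is a GRing.unit -> z%:A - x \is a GRing.unit.
Proof.
move=> /factor_theorem[Q ->]; rewrite rmorphM rmorphB /= horner_algX horner_algC.
rewrite unitrM_comm; first by move=> /andP[_]; rewrite -unitrN opprB.
have := rmorphM (horner_alg x) Q ('X - z%:P); rewrite mulrC rmorphM rmorphB /=.
by rewrite horner_algX horner_algC => /esym.
Qed.

Lemma alg_sub_unit_of_exp x z : (z ^+ p)%:A - x ^+ p \is a GRing.unit ->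
  z%:A - x \is a GRing.unit.
Proof.
move=> h; apply: (@alg_sub_unit_of_root ('X^p - (z ^+ p)%:P)).
  by rewrite /root !hornerE subrr.
by rewrite rmorphB rmorphXn /= horner_algX horner_algC -unitrN opprB.
Qed.

(** * The Newton limit and its spectrum *)

Section newton_root.
Variable a : A.
Hypothesis a1 : cnorm (1 - a) < 1.
Let b := 1 - a.

Lemma newtonE k : newton p a k = newton_iter p kappa b k.
Proof.
elim: k => //= k ->; set X := newton_iter p kappa b k; set e := residual p kappa b k.
have [y [yX Xy]] := newton_iter_inverse nA p1 kappaC kappap kappaN a1 k.
have XU : X \is a GRing.unit by apply/unitrP; exists y.
have Xe : X ^- p * a = 1 - e.
  have := newton_iter_residual nA p1 kappaC kappap kappaN a1 k.
  rewrite -/b -/X -/e opprB addrCA subrr addr0 => <-.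
  by rewrite mulrA mulVr ?mul1r// unitrX.
rewrite Xe scalerAr; congr (_ * _).
rewrite addrA natr1 prednK// scalerBr -scalerAl mul1r; congr (_ - _).
by rewrite -(scaler_nat p (1 : A)) scalerA mulVf ?scale1r// pnatr_eq0 -lt0n.
Qed.

Lemma newton_unit k : newton p a k \is a GRing.unit.
Proof.
have [y [yX Xy]] := newton_iter_inverse nA p1 kappaC kappap kappaN a1 k.
by rewrite newtonE; apply/unitrP; exists y.
Qed.

Lemma newton_converges_root : exists r, [/\ r ^+ p = a,
  rnorm_cvg (@cnorm R A) (newton_iter p kappa b) r, newton p a @ \oo --> r &
  exists C : R, forall k, cnorm (newton p a k - r) <= C * cnorm b ^+ (2 ^ k)].
Proof.
have [r [Xr rp [C Ck]]] := newton_limit nA p1 kappaC kappap kappaN a1.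
exists r; split=> //.
- by rewrite rp /b opprB addrCA subrr addr0.
- have b01 : 0 <= cnorm b < 1 by rewrite cnorm_ge0.
  have [|l [C' [Xl lC]]] := @banach_geometric_complete R A
    (newton_iter p kappa b) (newton_bound (@cnorm R A) b) _ b01.
    move=> n; apply: le_trans (newton_iter_step nA p1 kappaC kappap kappaN a1 n) _.
    by rewrite ler_wpM2l ?expR_ge0// le_expr_exp2n// cnorm_ge0 ltW.
  rewrite (rnorm_cvg_unique nA Xr (_ : rnorm_cvg _ _ l)); last by exists C', (cnorm b).
  by rewrite (_ : newton p a = newton_iter p kappa b)//; apply/funext => k; exact: newtonE.
- by exists C => k; rewrite newtonE; exact: Ck.
Qed.

Variable r : A.
Hypothesis rp : r ^+ p = a.
Hypothesis Xr : rnorm_cvg (@cnorm R A) (newton_iter p kappa b) r.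

Lemma newton_iter_alg (c : R[i]) k : normc c < 1 ->
  newton_iter p kappa (c%:A : A) k = (newton_iter p p%:R^-1 c k)%:A
  /\ residual p kappa (c%:A : A) k = (residual p p%:R^-1 c k)%:A.
Proof.
move=> c1; have nC := complex_ring_norm R.
have kC (x : R[i]) : p%:R^-1 * x = x * p%:R^-1 by rewrite mulrC.
have kN : cnorm (p%:R^-1 : R[i]^o) <= p%:R^-1 by rewrite cnorm_invr_nat.
elim: k => [|k [IH1 IH2]] /=; first by rewrite scale1r.
have e1 := residual_le1 nC p1 kC (mulrn_invr_natC R p1) kN c1 k.
have [w [wE wx xw _]] := kappa_inverse nC p1 kN e1.
set e := residual p p%:R^-1 c k in e1 wE wx xw IH2 *.
have ke : 1 - kappa * e%:A = (1 - p%:R^-1 * e)%:A.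
  by rewrite -scalerAl mul1r scalerA scalerBl scale1r.
split; rewrite IH2 ?IH1.
  by rewrite ke -scalerAl mul1r scalerA.
rewrite /residual_step ke wE (@two_sided_inverseE _ _ (w%:A)).
- rewrite exprZn expr1n scalerBl scale1r; congr (_ - _).
  by rewrite -scalerAl mul1r -scalerA scalerBl scale1r.
- by rewrite -scalerAl mul1r scalerA wx scale1r.
- by rewrite -scalerAl mul1r scalerA xw scale1r.
Qed.

(** The point [z] is the scalar Newton limit. Divided differences for the diagonals [(a, 1 - c)] and
    [(1 - c, a)] give a right and a left inverse up to the scalar [- t]. *)
Lemma root_quotient_unit z c : normc c < 1 -> open_sector p z -> z ^+ p = 1 - c ->
  \sum_(i < p) z ^+ (p.-1 - i) *: r ^+ i \is a GRing.unit.
Proof.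
move=> c1 zp zc; have [zeta [Xz zetac zetap]] := newton_scalar_root p1 c1.
have {zp zc zetac zetap} zE : zeta = z.
  by apply: (open_sector_exp_inj p0 zetap zp); rewrite zetac.
rewrite {}zE in Xz.
have Xz' : rnorm_cvg (@cnorm R A) (newton_iter p kappa (c%:A : A)) (z%:A).
  move: Xz => [C [q [q01 h]]]; exists C, q; split=> // n.
  by have [-> _] := newton_iter_alg n c1; rewrite -scalerBl cnorm_alg.
(* Half of the remaining room: both triangular matrices have residual of norm below 1. *)
pose t : R := (1 - Num.max (cnorm b) (normc c)) / 2.
have t0 : 0 < t by rewrite divr_gt0// subr_gt0 gt_max a1.
have tN : cnorm (t%:C%:A : A) = t by rewrite cnorm_alg cnorm_real gtr0_norm.
have cN : cnorm (c%:A : A) < 1 by rewrite cnorm_alg.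
have [b_le c_le] : cnorm b <= 1 - t *+ 2 /\ normc c <= 1 - t *+ 2.
  have -> : 1 - t *+ 2 = Num.max (cnorm b) (normc c).
    have -> : t *+ 2 = 1 - Num.max (cnorm b) (normc c).
      by rewrite -[LHS]mulr_natr divfK// pnatr_eq0.
    by rewrite opprB addrCA subrr addr0.
  by rewrite !le_max !lexx orbT.
rewrite mulr2n in b_le c_le.
have [|h hE] := newton_limit_divided_difference nA p1 kappaC kappap kappaN
  (eta := t%:C%:A) a1 cN _ Xr Xz'; first by rewrite tN -/b; lra.
have [|h' h'E] := newton_limit_divided_difference nA p1 kappaC kappap kappaN
  (eta := t%:C%:A) cN a1 _ Xz' Xr; first by
  rewrite tN cnorm_alg; have : cnorm (c : R[i]^o) = normc c by []; lra.
set Q := \sum_(i < p) _.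
have tU : - (t%:C%:A : A) \is a GRing.unit.
  by rewrite unitrN scaler_unit ?unitr1 ?unitfE// eq_complex /= gt_eqF.
have Qh : Q * h = - t%:C%:A.
  rewrite -hE mulr_suml; apply: eq_bigr => i _.
  by rewrite exprZn expr1n -scalerAl -scalerAr mulr1.
have hQ : h' * Q = - t%:C%:A.
  rewrite -h'E mulr_sumr (reindex_inj rev_ord_inj); apply: eq_bigr => i _.
  rewrite exprZn expr1n -scalerAl mul1r -scalerAl -scalerAr /=.
  have -> : (p - i.+1 = p.-1 - i)%N by rewrite -subn1 -subnDA add1n.
  by rewrite subKn// -ltnS prednK.
set u := - _ in tU Qh hQ.
have Qu : Q * (h * u^-1) = 1 by rewrite mulrA Qh mulrV.
have uQ : u^-1 * h' * Q = 1 by rewrite -mulrA hQ mulVr.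
apply/unitrP; exists (h * u^-1); split=> //.
by rewrite -(inverse_unique uQ Qu).
Qed.

(** For [z] outside the sector, either [z ^+ p] is at distance at least 1 from 1, hence off the
    spectrum of [a], or [z] differs from the principal root [zeta] of [z ^+ p] and is a root of
    [(X^p - zeta^p) / (X - zeta)], which takes an invertible value at [r]. *)
Lemma spectrum_newton_root : spectrum r `<=` open_sector p.
Proof.
move=> z; rewrite /spectrum /= => zr; apply: contrapT => zp.
move/negP: zr; apply.
have [c1|c1] := ltP (normc (1 - z ^+ p)) 1; last first.
  apply: alg_sub_unit_of_exp; rewrite rp.
  have -> : (z ^+ p)%:A - a = - ((1 - z ^+ p)%:A - b).
    by rewrite /b scalerBl scale1r !opprB [RHS]addrC addrA subrK.
  by rewrite unitrN alg_sub_unit// (lt_le_trans a1).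
have [zeta [_ zetac zetap]] := newton_scalar_root p1 c1.
have {}zetac : zeta ^+ p = z ^+ p by rewrite zetac opprB addrCA subrr addr0.
have zN : z - zeta != 0.
  by rewrite subr_eq0; apply/eqP => zE; apply: zp; rewrite zE.
apply: (@alg_sub_unit_of_root (\sum_(i < p) zeta ^+ (p.-1 - i) *: 'X^i)).
  have := subrXX zeta z p; rewrite zetac subrr => /esym/eqP.
  rewrite mulf_eq0 -oppr_eq0 opprB (negbTE zN) /= => /eqP e.
  rewrite /root horner_sum -[X in _ == X]e; apply/eqP/eq_bigr => i _.
  by rewrite !hornerE.
rewrite raddf_sum; under eq_bigr do rewrite /= linearZ /= rmorphXn /= horner_algX mulr_algl.
apply: (root_quotient_unit c1 zetap); first by rewrite zetac opprB addrCA subrr addr0.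
Qed.

Lemma newton_root_comm s : GRing.comm s b -> GRing.comm s r.
Proof.
move=> sb; apply: (rnorm_cvg_unique nA (u := fun k => s * newton_iter p kappa b k)).
  by apply: rnorm_cvgM => //; exact: rnorm_cvg_cst.
under eq_fun do rewrite (newton_iter_comm nA p1 kappaC kappap kappaN a1 _ sb).
by apply: rnorm_cvgM => //; exact: rnorm_cvg_cst.
Qed.

Let aU : a \is a GRing.unit.
Proof. by have := neumann_unit a1; rewrite opprB addrCA subrr addr0. Qed.

Let rU : r \is a GRing.unit.
Proof. by rewrite -(unitrX_pos _ p0) rp. Qed.

(** * Uniqueness of the root with spectrum in the sector *)

Section uniqueness.
Variable s : A.
Hypothesis sp : s ^+ p = a.
Hypothesis s_sector : spectrum s `<=` open_sector p.

Let sr : GRing.comm s r.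
Proof.
apply: newton_root_comm; apply: commrB; first exact: commr1.
by rewrite -sp; exact: commrX.
Qed.

Let u := s * r^-1.

Let ru : GRing.comm r u.
Proof. by apply: commrM; [exact: commr_sym|apply: commrV]. Qed.

Let us : GRing.comm u s.
Proof.
by apply/commr_sym/commrM => //; exact: commrV.
Qed.

Let up : u ^+ p = 1.
Proof.
by rewrite exprMn_comm; [rewrite sp exprVn rp mulrV|exact: commrV].
Qed.

Let us_ur : s = u * r. Proof. by rewrite divrK. Qed.

(* Up to the factor [p] this is the spectral projection of [s / r] at [omega^-1].
   On its range [s = omega^-1 r], which makes the spectrum of [r] there empty. *)
Lemma root_ratio_projection_eq0 (omega : R[i]) : omega ^+ p = 1 -> omega != 1 ->
  \sum_(i < p) (omega *: u) ^+ i = 0.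
Proof.
move=> omegap omega1; set y := omega *: u; set S := \sum_(i < p) _.
have omega0 : omega != 0.
  by apply: contra_eq_neq omegap => ->; rewrite expr0n gtn_eqF// eq_sym oner_eq0.
have yp : y ^+ p = 1 by rewrite exprZn omegap scale1r up.
have yS : y * S = S.
  by apply/eqP; rewrite -subr_eq0 -[X in _ - X]mul1r -mulrBl -subrX1 yp subrr.
have yiS i : y ^+ i * S = S.
  by elim: i => [|i IH]; rewrite ?expr0 ?mul1r// exprSr -mulrA yS.
have SS : S * S = p%:R *: S.
  rewrite {1}/S mulr_suml; under eq_bigr do rewrite yiS.
  by rewrite sumr_const card_ord scaler_nat.
have pN0 : p%:R != 0 :> R[i] by rewrite pnatr_eq0 -lt0n.
have commS x : GRing.comm x u -> GRing.comm x S.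
  move=> xu; apply: commr_sum => i _; apply: commrX.
  by rewrite /GRing.comm -scalerAr xu scalerAl.
pose e := (p%:R^-1 : R[i]) *: S.
have commE x : GRing.comm x u -> GRing.comm e x.
  by move=> /commS xS; rewrite /GRing.comm -scalerAl -xS scalerAr.
have se : s * e = omega^-1 *: (r * e).
  have ue : u * e = omega^-1 *: e.
    have uS : u * S = omega^-1 *: S.
      by rewrite -{2}yS /y -scalerAl scalerA mulVf// scale1r.
    by rewrite /e -scalerAr uS !scalerA mulrC.
  by rewrite us_ur -ru -mulrA ue scalerAr.
suff e0 : e = 0.
  by apply/eqP; move/eqP: e0; rewrite scaler_eq0 invr_eq0 (negbTE pN0).
apply: (@idempotent_eq0_of_empty_spectrum _ _ e r) => //.
- by rewrite /e -scalerAl -scalerAr SS !scalerA -mulrA mulVf// mulr1.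
- exact/commE.
- move=> v; have [->|v0] := eqVneq v 0.
    exists 1; split; [exact: unitr1|exact: commr1|].
    by rewrite scale0r subr0.
  have scal (c : R[i]) x : c != 0 -> x \is a GRing.unit -> c *: x \is a GRing.unit.
    by move=> c0; rewrite scaler_unit// unitfE.
  (* The points [v^-1] and [(omega * v)^-1] are distinct with equal pth powers, so at most one lies
     in the sector. Hence [1 - v r] or [1 - omega v s] is invertible, and the two agree on the range
     of [e]. *)
  have [zp|zp] := pselect (open_sector p v^-1); last first.
    exists (1 - v *: r); split=> //.
      have -> : 1 - v *: r = v *: (v^-1%:A - r).
        by rewrite scalerBr scalerA divff// scale1r.
      apply: scal => //; apply: contrapT => /negP h; apply: zp.
      exact: spectrum_newton_root.
    by apply: commrB; [exact: commr1|rewrite /GRing.comm -scalerAr (commE r)// scalerAl].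
  have w0 : omega * v != 0 by rewrite mulf_neq0.
  exists (1 - (omega * v) *: s); split.
  - have -> : 1 - (omega * v) *: s = (omega * v) *: ((omega * v)^-1%:A - s).
      by rewrite scalerBr scalerA divff// scale1r.
    apply: scal => //; apply: contrapT => /negP /s_sector wp.
    have := open_sector_exp_inj p0 wp zp.
    rewrite invfM exprMn exprVn omegap invr1 mul1r => /(_ erefl) /eqP.
    rewrite -[X in _ == X]mul1r (inj_eq (mulIf _)) ?invr_eq0//.
    by rewrite invr_eq1 (negbTE omega1).
  - apply: commrB; first exact: commr1.
    by rewrite /GRing.comm -scalerAr (commE s) ?scalerAl//; exact: commr_sym.
  - rewrite !mulrBl !mul1r -scalerAl se scalerA mulrAC divff// mul1r.
    by rewrite -scalerAl.
Qed.

(** Summed over all pth roots of unity the projection sums give [p], by orthogonality; only the one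
    at 1 survives. Thus [sum u^i = p], and as [u] fixes this sum, [u = 1]. *)
Lemma newton_root_unique : s = r.
Proof.
pose tau : R[i] := expi (pi *+ 2 / p%:R).
have taup : tau ^+ p = 1.
  by rewrite expiX -[X in expi X]mulr_natr divfK ?pnatr_eq0 -?lt0n// /expi cos2pi sin2pi.
have pR : 0 < p%:R :> R by rewrite ltr0n.
have tau1 i : (0 < i < p)%N -> tau ^+ i != 1.
  move=> /andP[i0 ip]; apply/eqP; rewrite expiX -(expi0 R).
  have t0 : 0 < pi *+ 2 / p%:R *+ i :> R.
    by rewrite pmulrn_lgt0// divr_gt0// pmulrn_lgt0// pi_gt0.
  move/expi_inj; rewrite subr0 gtr0_norm// => h.
  suff e0 : pi *+ 2 / p%:R *+ i = 0 :> R by move: t0; rewrite e0 ltxx.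
  apply: h; rewrite -[ltLHS]mulr_natr mulrAC ltr_pdivrMr// ltr_pM2l ?ltr_nat//.
  by rewrite pmulrn_lgt0// pi_gt0.
have : \sum_(j < p) \sum_(i < p) (tau ^+ j *: u) ^+ i = \sum_(i < p) u ^+ i.
  rewrite (bigD1 (Ordinal p0))//= expr0 scale1r [X in _ + X]big1 ?addr0// => j j0.
  apply: root_ratio_projection_eq0; first by rewrite -exprM mulnC exprM taup expr1n.
  by apply: tau1; rewrite lt0n ltn_ord andbT; move: j0; rewrite -val_eqE.
rewrite exchange_big /= (bigD1 (Ordinal p0))//= [X in _ + X]big1 ?addr0; last first.
  move=> i i0; under eq_bigr do rewrite exprZn -exprM mulnC exprM.
  rewrite -scaler_suml.
  have /eqP := subrX1 (tau ^+ i) p; rewrite -exprM mulnC exprM taup expr1n subrr.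
  rewrite eq_sym mulf_eq0 subr_eq0 (negbTE (tau1 i _)).
    by move=> /= /eqP ->; rewrite scale0r.
  by rewrite lt0n ltn_ord andbT; move: i0; rewrite -val_eqE.
under eq_bigr do rewrite expr0.
rewrite sumr_const card_ord => pS.
have u1 : u = 1.
  have : u * \sum_(i < p) u ^+ i = \sum_(i < p) u ^+ i.
    by apply/eqP; rewrite -subr_eq0 -[X in _ - X]mul1r -mulrBl -subrX1 up subrr.
  rewrite -pS mulr_natr -(scaler_nat p u) -(scaler_nat p (1 : A)).
  move=> /(congr1 (fun x : A => (p%:R^-1 : R[i]) *: x)).
  by rewrite !scalerA mulVf ?scale1r// pnatr_eq0 -lt0n.
by rewrite us_ur u1 mul1r.
Qed.

End uniqueness.

Lemma newton_root_principal : is_principal_root p a r.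
Proof.
split.
- apply/seteqP; split=> // z [/= az [t t0 tz]].
  move/negP: az; apply.
  have -> : z%:A - a = - ((1 - z)%:A - b).
    by rewrite /b scalerBl scale1r !opprB [RHS]addrC addrA subrK.
  rewrite unitrN alg_sub_unit// (lt_le_trans a1)// -tz.
  rewrite (_ : 1 - t%:C = (1 - t)%:C); last by rewrite rmorphB.
  (* A nonpositive real [t] has [|1 - t| >= 1], beyond the norm of [b]. *)
  by rewrite /= expr0n /= addr0 sqrtr_sqr ger0_norm; rewrite /= in t0; lra.
- by split=> //; rewrite interior_sector//; exact: spectrum_newton_root.
- by move=> s [sp]; rewrite interior_sector// => h; exact: newton_root_unique.
Qed.

End newton_root.

Lemma newton_converges_of_norm_lt1 a : `|1 - a| < 1 -> newton_converges p a.
Proof.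
rewrite -(rmorph1 (real_complex R)) -cnorm_ltC => a1.
split; first exact: newton_unit.
have [r [rp Xr newtonr [C Ck]]] := newton_converges_root a1.
exists r; split=> //; first exact: newton_root_principal.
exists (cnorm (1 - a)), C; split=> // [|k]; first exact: cnorm_ge0.
by rewrite -cnorm_leC.
Qed.

End principal_root.

Unset Implicit Arguments.

Theorem proposition7p3 (R : realType) (A : banachAlgType R[i]) (p : nat)
    (hp : (1 < p)%N) :
  (forall a : A, `|1 - a| < 1 -> newton_converges p a) /\
  (forall a : A, strictly_accretive a -> `|1 - 2%:R * a| <= 1 ->
     newton_converges p a).
Proof.
split=> [a|a aacc a2]; first exact: newton_converges_of_norm_lt1.
by apply: newton_converges_of_norm_lt1 => //; exact: accretive_norm_lt1.
Qed.
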